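(* Let $\alpha>-1$ and $\beta>0$, and let $T$, $a$, $b$ be the first passage time of the geometric Brownian motion and its parameters as defined in the context. Set $A=\frac{a}{b^2}-\beta$. Then the condition $$\int_0^\infty t^{-(\alpha+3)}\exp\left(-At-\frac{a}{t}\right)dt<\infty$$ is fulfilled if and only if $$\beta\le\frac{c_1[T]}{c_2[T]}=\frac{1}{\sigma^2}\left(\mu-\frac{\sigma^2}{2}\right)^2,$$ where $c_1[T]$ and $c_2[T]$ are the first and the second cumulant of $T$, respectively.
   Context: Setting: $W$ is a standard Brownian motion, $\sigma>0$, $\mu>\sigma^2/2$, $y_0>0$, and $Y(t)=y_0\,e^{(\mu-\sigma^2/2)t+\sigma W(t)}$, $t\ge 0$, is the geometric Brownian motion. $S$ is a constant with $S>y_0$, and $T=\inf\{t\ge 0: Y(t)>S\}$. Put $$a=\frac{(\ln S-\ln y_0)^2}{\sigma^2}>0,\qquad b=\frac{\ln S-\ln y_0}{\mu-\sigma^2/2}>0 .$$ $T$ has the inverse Gaussian probability density $g(t)=\sqrt{\frac{a}{2\pi t^3}}\exp\left(-\frac{a(t-b)^2}{2b^2t}\right)$, $t>0$. The cumulants $c_k[T]$ are defined by $\sum_{k\ge1}c_k[T]\frac{z^k}{k!}=\log\mathbb{E}[e^{zT}]$ for $z$ in an open interval about $0$; so $c_1[T]$ is the mean and $c_2[T]$ the variance of $T$. *)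

(* Defs.v *)
From mathcomp Require Export all_boot all_order all_algebra.
From mathcomp Require Export all_classical all_reals all_analysis.
Export Order.TTheory GRing.Theory Num.Theory.
Export numFieldNormedType.Exports.

Set Implicit Arguments.
Unset Strict Implicit.
Unset Printing Implicit Defensive.

Local Open Scope classical_set_scope.
Local Open Scope ring_scope.

Section brownian_motion.
Context {d : measure_display} {Omega : measurableType d} {R : realType}.
Context (P : probability Omega R).
Implicit Type W : R -> {RV P >-> R}.

(* The sigma-algebra generated by the variables W u, 0 <= u <= s. *)
Definition past W (s : R) : set (set Omega) :=
  <<s \bigcup_(u in `[0, s])
        preimage_set_system [set: Omega] (W u) measurable >>.

(* The time set is [0, +oo[: the values of W at negative times are
   unconstrained.  The second parameter of [normal_prob] is the standard
   deviation. *)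
Record standard_brownian_motion W : Prop := {
  bm_start : {ae P, forall w, W 0 w = 0} ;
  bm_indep : forall s t : R, 0 <= s -> s < t ->
    forall (A : set Omega) (B : set R), past W s A -> measurable B ->
      P (A `&` [set w | B (W t w - W s w)%R])
      = (P A * P [set w | B (W t w - W s w)%R])%E ;
  bm_normal : forall s t : R, 0 <= s -> s < t ->
    forall B : set R, measurable B ->
      P [set w | B (W t w - W s w)%R] = normal_prob 0 (Num.sqrt (t - s)) B ;
  bm_continuous : forall w, {within `[0, +oo[, continuous (fun t => W t w)}
}.

Definition geometric_bm W (mu sigma y0 : R) (t : R) (w : Omega) : R :=
  y0 * expR ((mu - sigma ^+ 2 / 2) * t + sigma * W t w).

End brownian_motion.

Section first_passage_time.
Context {Omega : Type} {R : realType}.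

(* The infimum is +oo when Y never exceeds S. *)
Definition first_passage (Y : R -> Omega -> R) (S : R) (w : Omega) : \bar R :=
  ereal_inf [set t%:E | t in [set t : R | 0 <= t /\ S < Y t w]].

End first_passage_time.

Section cumulants.
Context {d : measure_display} {Omega : measurableType d} {R : realType}.
Context (P : probability Omega R).

(* E[exp (z X)]; the library's 'M_P only covers real-valued variables. *)
Definition mgf (X : Omega -> \bar R) (z : R) : \bar R :=
  (\int[P]_w expeR (z%:E * X w))%E.

Definition is_cumulant_seq (X : Omega -> \bar R) (c : nat -> R) : Prop :=
  exists2 r : R, 0 < r & forall z : R, `|z| < r ->
    mgf X z \is a fin_num /\
    (fun n => \sum_(1 <= k < n) c k * (z ^+ k / k`!%:R)) @ \oo
      --> ln (fine (mgf X z)).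

(* The k-th cumulant (k >= 1) of X.  Coefficients of a convergent power series
   are unique, so the choice made by [xget] does not matter for k >= 1; if X
   has no cumulant generating function near 0, the value is 0. *)
Definition cumulant (X : Omega -> \bar R) (k : nat) : R :=
  xget (fun _ => 0) [set c | is_cumulant_seq X c] k.

End cumulants.

Section parameters.
Context {R : realType}.

Definition ig_a (sigma y0 S : R) : R := (ln S - ln y0) ^+ 2 / sigma ^+ 2.

Definition ig_b (mu sigma y0 S : R) : R :=
  (ln S - ln y0) / (mu - sigma ^+ 2 / 2).

End parameters.

(* Main.v *)
(* Dividing by sigma turns the passage problem into that of the drifted Brownian
   motion X_t = m t + W_t at the level h, with m = (mu - sigma^2/2) / sigma and
   h = (ln S - ln y0) / sigma, so that a / b^2 = m^2.  With
   psi q = q^2/2 + m q (named cgf), exp (q X_t - psi q t) has mean one; stopping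
   it when X, sampled on the grid 4^-n N, first exceeds h, and letting n tend to
   infinity yields E[exp (- psi q T)] = exp (- q h) for small q.  Solving
   psi q = - z gives E[exp (z T)] = exp (h (m - sqrt (m^2 - 2 z))), and the
   binomial series of the square root gives the cumulants h / m and h / m^3.
   The integral converges if and only if A = m^2 - beta is nonnegative: the
   factor exp (- a / t) controls t = 0, and t^-(alpha+3) with alpha + 3 > 2
   controls infinity as soon as A >= 0. *)

(* The obstacle is the passage to the limit in the grid. At its first grid crossing X lies above h
   by an unbounded amount, so the stopped exponentials have no evident common bound. They are
   therefore replaced by copies in which X is capped at h + 1. The two differ only if one increment
   over a mesh of 4^-n exceeds 1, while its standard deviation is 2^-n; an exponential bound with
   parameter 2^n makes the total error over all n 4^n steps tend to 0. Powers of 4 thus give a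
   standard deviation without square roots, and they put the integers on every grid. Stage n stops
   observing at time n; the contribution of the paths still below h decays geometrically because the
   drift m is positive.

   Capping bounds exp (q X) but not exp (- psi q t), which grows with t when psi q < 0. The factor
   is dominated by a sum over the integers j with X_j <= h, integrable for |psi q| <= m^2/4. The
   same sum shows that T is finite almost surely. Continuity of the paths enters through X_T = h and
   through the convergence of the grid crossing times to T. *)
From HB Require Import structures.
Require Import Defs.
From mathcomp Require Import measurable_realfun ring lra.

Set Implicit Arguments.
Unset Strict Implicit.
Unset Printing Implicit Defensive.

Local Open Scope classical_set_scope.
Local Open Scope ring_scope.

(** * Convergence of the generalized inverse Gaussian integral *)

Section exponential_kernel.
Context {R : realType}.
Implicit Types (a p A t : R).

Definition gig_kernel a p A t := t `^ (- p) * expR (- A * t - a / t).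

(** One term of the exponential series bounds the whole from below. This is the only form in which
    exponentials beat powers below: in both directions of the convergence criterion and in the
    summation of the overshoot errors. *)
Lemma expr_le_factM_expR (x : R) n : 0 <= x -> x ^+ n.+1 <= n.+1`!%:R * expR x.
Proof.
move=> x0; rewrite -ler_pdivrMl ?ltr0n ?fact_gt0// mulrC.
by apply: le_trans (expR_ge1Dxn n x0); rewrite lerDr.
Qed.

Lemma measurable_gig_kernel a p A :
  measurable_fun (`]0, +oo[%classic : set R) (gig_kernel a p A).
Proof.
apply: (eq_measurable_fun
    (fun t => t `^ (- p) * expR (- A * t - a * t `^ (- 1)))).
  by move=> t; rewrite inE/= in_itv/= andbT => t0; rewrite /gig_kernel powR_inv1 ?ltW.
apply: measurable_funTS; apply: measurable_funM; first exact: measurable_powR.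
apply: measurableT_comp => //; apply: measurable_funB.
  exact: measurable_funM.
by apply: measurable_funM => //; exact: measurable_powR.
Qed.

Lemma gig_kernel_ge0 a p A t : 0 <= gig_kernel a p A t.
Proof. by rewrite mulr_ge0 ?powR_ge0 ?expR_ge0. Qed.

(** Near 0 the factor exp (- a / t) is at most (n+1)! (t / a)^(n+1), and this power of t cancels the
    singularity t^-(n+1), which dominates t^-p. *)
Lemma gig_kernel_small a p A t : 0 < a -> 0 <= A -> 0 < t <= 1 ->
  forall n : nat, p <= n.+1%:R -> gig_kernel a p A t <= n.+1`!%:R / a ^+ n.+1.
Proof.
move=> a0 A0 /andP[t0 t1] n pn.
have at0 : 0 < a / t by rewrite divr_gt0.
have h1 : t `^ (- p) <= (t ^+ n.+1)^-1.
  by rewrite -powR_invn ?(ltW t0)// ger_powR ?t0// lerN2.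
have h2 : expR (- A * t - a / t) <= n.+1`!%:R * (t ^+ n.+1 / a ^+ n.+1).
  apply: (@le_trans _ _ (expR (- (a / t)))).
    by rewrite ler_expR gerDr mulNr oppr_le0 mulr_ge0// ltW.
  have := expr_le_factM_expR n (ltW at0).
  rewrite expRN -[_ / _ ^+ _]invf_div -expr_div_n => H.
  by rewrite ler_pdivlMr ?exprn_gt0// mulrC ler_pdivrMr ?expR_gt0.
apply: (le_trans (ler_pM (powR_ge0 _ _) (expR_ge0 _) h1 h2)).
rewrite mulrCA mulKf//; first by rewrite gt_eqF// exprn_gt0.
Qed.

Lemma gig_kernel_large a p A t : 0 < a -> 0 <= A -> 1 <= t -> 2 <= p ->
  gig_kernel a p A t <= (t ^+ 2)^-1.
Proof.
move=> a0 A0 t1 p2; have t0 : 0 < t by rewrite (lt_le_trans _ t1).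
rewrite -[leRHS]mulr1 ler_pM ?powR_ge0 ?expR_ge0//.
  by rewrite -powR_invn ?(ltW t0)// ler_powR// lerN2.
rewrite -expR0 ler_expR mulNr -opprD oppr_le0.
by rewrite addr_ge0 ?mulr_ge0 ?invr_ge0 ?(ltW t0) ?(ltW a0).
Qed.

(** The bounds on ]0, 1] and on [1, +oo[ are merged into one multiple of 1 / (1 + t^2), whose
    integral is known. The factor 2 in [C] comes from 1 + t^2 <= 2 for t <= 1 and 1 + t^2 <= 2 t^2
    for t >= 1. *)
Lemma gig_kernel_integral_finite a p A : 0 < a -> 0 <= A -> 2 <= p ->
  (\int[lebesgue_measure]_(t in `]0%R, +oo[) (gig_kernel a p A t)%:E < +oo)%E.
Proof.
move=> a0 A0 p2.
pose n := Num.truncn p; have pn : p <= n.+1%:R by rewrite ltW// truncnS_gt.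
pose C := Num.max 1 (n.+1`!%:R / a ^+ n.+1) * 2.
have C0 : 0 <= C by rewrite mulr_ge0// le_max ler01.
have le_C t : 0 < t -> gig_kernel a p A t <= C * (oneDsqr t)^-1.
  move=> t0; rewrite /oneDsqr /C; have [t1|t1] := leP t 1.
    apply: (@le_trans _ _ (n.+1`!%:R / a ^+ n.+1)); first by rewrite gig_kernel_small// t0.
    rewrite -mulrA -[leLHS]mulr1 ler_pM//.
    - by rewrite divr_ge0// exprn_ge0// ltW.
    - by rewrite le_max lexx orbT.
    - rewrite -ler_pdivrMl// mulr1 lef_pV2 ?posrE//; last first.
        by rewrite ltr_pwDl// exprn_ge0// ltW.
      have : t ^+ 2 <= 1 by rewrite exprn_ile1// ltW.
      by move=> ?; rewrite -[leRHS]/(1 + 1) lerD2l.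
  apply: (@le_trans _ _ ((t ^+ 2)^-1)); first by rewrite gig_kernel_large// ltW.
  rewrite -mulrA -[leLHS]mul1r ler_pM//.
  - by rewrite invr_ge0 sqr_ge0.
  - by rewrite le_max lexx.
  - have t2 : 1 <= t ^+ 2 by rewrite exprn_ege1// ltW.
    rewrite -ler_pdivrMl// -invfM lef_pV2 ?posrE ?mulr_gt0 ?exprn_gt0 ?ltr_pwDl//;
      last by rewrite exprn_ge0// ltW.
    by rewrite mulr_natl mulr2n lerD2r.
have mI : measurable_fun (`[0%R, +oo[%classic : set R)
    (fun t : R => (C * (oneDsqr t)^-1)%:E).
  apply: measurable_funTS; apply/measurable_EFinP; apply: measurable_funM => //.
  by apply: continuous_measurable_fun => t; exact: continuous_oneDsqrV.
have I0 t : (0 <= (C * (oneDsqr t)^-1)%:E)%E.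
  by rewrite lee_fin mulr_ge0// invr_ge0 /oneDsqr addr_ge0// sqr_ge0.
apply: (@le_lt_trans _ _ (\int[lebesgue_measure]_(t in `[0%R, +oo[)
    (C * (oneDsqr t)^-1)%:E)%E); last first.
  under eq_integral do rewrite EFinM.
  rewrite ge0_integralZl//=.
  - by rewrite integral0y_oneDsqr -EFinM ltry.
  - apply: measurable_funTS; apply/measurable_EFinP.
    by apply: continuous_measurable_fun => t; exact: continuous_oneDsqrV.
have sub : (`]0%R, +oo[%classic : set R) `<=` `[0%R, +oo[%classic.
  by move=> t/=; rewrite !in_itv/= !andbT => /ltW.
apply: (@le_trans _ _ (\int[lebesgue_measure]_(t in `]0%R, +oo[)
    (C * (oneDsqr t)^-1)%:E)%E); last exact: ge0_subset_integral.
apply: ge0_le_integral => //.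
- by move=> t _; rewrite lee_fin gig_kernel_ge0.
- by apply/measurable_EFinP; exact: measurable_gig_kernel.
- exact: measurable_funS mI.
- by move=> t/=; rewrite in_itv/= andbT lee_fin => /le_C.
Qed.

(** For A < 0 the factor exp (- A t) outgrows t^p and exp (- a / t) >= exp (- a) on [1, +oo[, so the
    kernel stays above a positive constant there. *)
Lemma gig_kernel_integral_infinite a p A : 0 < a -> A < 0 ->
  (\int[lebesgue_measure]_(t in `]0%R, +oo[) (gig_kernel a p A t)%:E = +oo)%E.
Proof.
move=> a0 A0; pose n := Num.truncn p; have pn : p <= n.+1%:R by rewrite ltW// truncnS_gt.
pose c := (- A) ^+ n.+1 / n.+1`!%:R * expR (- a).
have c0 : 0 < c.
  by rewrite mulr_gt0 ?expR_gt0// divr_gt0 ?ltr0n ?fact_gt0// exprn_gt0// oppr_gt0.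
have ge_c t : 1 <= t -> c <= gig_kernel a p A t.
  move=> t1; have t0 : 0 < t by rewrite (lt_le_trans _ t1).
  rewrite /gig_kernel expRD mulrA /c ler_pM ?expR_ge0//.
  - by rewrite divr_ge0// exprn_ge0// oppr_ge0 ltW.
  - rewrite powRN [leRHS]mulrC ler_pdivlMr ?powR_gt0//.
    have At0 : 0 <= - A * t by rewrite mulr_ge0 ?ltW// oppr_gt0.
    have := expr_le_factM_expR n At0.
    rewrite -ler_pdivrMl ?ltr0n ?fact_gt0//; apply: le_trans.
    rewrite exprMn mulrA [_^-1 * _]mulrC ler_wpM2l//.
      by rewrite divr_ge0// exprn_ge0// oppr_ge0 ltW.
    by rewrite -powR_mulrn ?(ltW t0)// ler_powR.
  - rewrite ler_expR lerN2 ler_pdivrMr// ler_peMr//; exact: ltW.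
apply/eqP; rewrite -leye_eq.
have sub : (`[1%R, +oo[%classic : set R) `<=` `]0%R, +oo[%classic.
  by move=> t/=; rewrite !in_itv/= !andbT => /(lt_le_trans ltr01).
have mk : measurable_fun (`]0%R, +oo[%classic : set R)
    (fun t => (gig_kernel a p A t)%:E).
  by apply/measurable_EFinP; exact: measurable_gig_kernel.
apply: (@le_trans _ _ (\int[lebesgue_measure]_(t in `[1%R, +oo[)
    (gig_kernel a p A t)%:E)%E); last first.
  apply: ge0_subset_integral => // t _; by rewrite lee_fin gig_kernel_ge0.
apply: (@le_trans _ _ (\int[lebesgue_measure]_(t in `[1%R, +oo[) cst c%:E t)%E).
  by rewrite integral_cst//= lebesgue_measure_itv/= ltry addye// gt0_muley.
apply: ge0_le_integral => //.
- by move=> t _; rewrite lee_fin ltW.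
- exact: measurable_funS mk.
- by move=> t/=; rewrite in_itv/= andbT lee_fin => /ge_c.
Qed.

Lemma gig_kernel_integral_finiteP a p A : 0 < a -> 2 <= p ->
  (\int[lebesgue_measure]_(t in `]0%R, +oo[)
      (t `^ (- p) * expR (- A * t - a / t))%:E < +oo)%E <-> 0 <= A.
Proof.
move=> a0 p2; split=> [|A0]; last exact: gig_kernel_integral_finite.
rewrite leNgt; apply: contraPN => A0.
by rewrite (gig_kernel_integral_infinite p a0 A0) ltxx.
Qed.

End exponential_kernel.

(** * Independence and the Gaussian moment generating function *)

Section independence.
Context {d : measure_display} {Omega : measurableType d} {R : realType}.
Context (P : probability Omega R).
Local Open Scope ereal_scope.

(** The joint law agrees with the product of the marginal laws on rectangles, hence is the product
    measure, and Tonelli's theorem applies. *)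
Lemma indep_ge0_expectationM (Z D : {RV P >-> R}) (f g : R -> \bar R) :
  (forall A B : set R, measurable A -> measurable B ->
     P (Z @^-1` A `&` D @^-1` B) = P (Z @^-1` A) * P (D @^-1` B)) ->
  measurable_fun setT f -> measurable_fun setT g ->
  (forall x, 0 <= f x) -> (forall x, 0 <= g x) ->
  \int[P]_w (f (Z w) * g (D w)) = \int[P]_w f (Z w) * \int[P]_w g (D w).
Proof.
move=> ZD mf mg f0 g0.
pose ZDp : Omega -> R * R := fun w => (Z w, D w).
have mZD : measurable_fun setT ZDp by exact: measurable_fun_pair.
pose H : R * R -> \bar R := fun z => f z.1 * g z.2.
have mH : measurable_fun setT H.
  by apply: emeasurable_funM; apply: measurableT_comp.
have H0 z : 0 <= H z by rewrite mule_ge0.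
transitivity (\int[pushforward P ZDp]_z H z).
  by rewrite ge0_integral_pushforward// preimage_setT.
transitivity (\int[distribution P Z \x distribution P D]_z H z).
  apply: eq_measure_integral => A mA _; apply/esym.
  by apply: (@product_measure_unique _ _ _ _ _ _ _ (pushforward P ZDp)).
rewrite fubini_tonelli1//.
transitivity (\int[distribution P Z]_x (f x * \int[distribution P D]_y g y)).
  apply: eq_integral => x _; rewrite /fubini_F /H/=.
  by rewrite ge0_integralZl.
rewrite ge0_integralZr//; last exact: integral_ge0.
by rewrite !ge0_integral_distribution.
Qed.

End independence.

Section gaussian.
Context {R : realType}.
Notation mu := (@lebesgue_measure R).
Local Open Scope ereal_scope.

(** The Radon-Nikodym derivative and the Gaussian density have the same integral over every
    measurable set, so they agree almost everywhere. *)
Lemma ge0_integral_normal_prob (m s : R) (f : R -> \bar R) :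
  measurable_fun setT f -> (forall x, 0 <= f x) ->
  \int[normal_prob m s]_x f x = \int[mu]_x (f x * (normal_pdf m s x)%:E).
Proof.
move=> mf f0.
have dom := normal_prob_dominates m s.
rewrite -(Radon_Nikodym_SigmaFinite.change_of_variables dom)//.
have Rint := Radon_Nikodym_SigmaFinite.f_integrable dom.
apply: ae_eq_integral => //.
- by apply: emeasurable_funM => //; exact: measurable_int Rint.
- apply: emeasurable_funM => //.
  by apply/measurable_EFinP; exact: measurable_normal_pdf.
- apply: ae_eqe_mul2l; apply: integral_ae_eq => //.
    by apply/measurable_EFinP; exact: measurable_normal_pdf.
  by move=> A _ mA; rewrite -Radon_Nikodym_SigmaFinite.f_integral.
Qed.

(** Completing the square turns exp (t x) times the centred density into a constant times the
    density centred at s^2 t. *)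
Lemma normal_mgf (s t : R) : s != 0%R ->
  \int[normal_prob 0 s]_x (expR (t * x))%:E = (expR (s ^+ 2 * t ^+ 2 / 2))%:E.
Proof.
move=> s0; rewrite ge0_integral_normal_prob//; last first.
  apply/measurable_EFinP; apply: measurableT_comp => //; exact: measurable_funM.
transitivity (\int[mu]_x ((expR (s ^+ 2 * t ^+ 2 / 2))%:E *
    (normal_pdf (s ^+ 2 * t) s x)%:E)).
  apply: eq_integral => x _.
  rewrite !normal_pdfE// -!EFinM; congr EFin.
  rewrite mulrCA [in RHS]mulrCA; congr (_ * _)%R.
  rewrite /normal_fun -!expRD; congr expR.
  by field.
rewrite ge0_integralZl//=.
- by rewrite integral_normal_pdf mule1.
- by apply/measurable_EFinP; exact: measurable_normal_pdf.
- by move=> x _; rewrite lee_fin normal_pdf_ge0.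
Qed.

End gaussian.

(** * Power series and cumulants *)

Section power_series.
Context {R : realType}.
Implicit Types (c e : nat -> R) (x r z : R).

(** The gap between 2 and 4 leaves room for the polynomial factors that two termwise
    differentiations put on bounded coefficients. *)
Lemma is_cvg_pseries_geometric_bound c M :
  (forall n, `|c n| <= M * 2 ^+ n) -> cvgn (pseries c (4^-1)).
Proof.
move=> cM; apply: normed_cvg; rewrite /normed_series_of.
have M0 : 0 <= M by have := cM 0%N; rewrite expr0 mulr1; apply: le_trans.
apply: (@series_le_cvg _ _ (geometric M (2^-1))).
- by move=> n; exact: normr_ge0.
- by move=> n; rewrite geometric_ge0// invr_ge0.
- move=> n /=; rewrite normrM normrX (@ger0_norm _ (4^-1))//.
  apply: (@le_trans _ _ (M * 2 ^+ n * 4^-1 ^+ n)).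
    by rewrite ler_wpM2r// exprn_ge0// invr_ge0.
  rewrite -mulrA -exprMn ler_wpM2l// le_eqVlt; apply/orP; left; apply/eqP.
  by congr (_ ^+ _); field.
- by apply: is_cvg_geometric_series; rewrite ger0_norm ?invf_lt1 ?invr_ge0// ltr1n.
Qed.

(** Convergence at z0 = r / 2 bounds the terms there by [C], so at x z0 all terms but the constant
    one add up to O(x). Letting x tend to 0 leaves the constant term. *)
Lemma pseries_eq0_coef0 e r : 0 < r ->
  (forall z, 0 < z < r -> pseries e z @ \oo --> 0) -> e 0%N = 0.
Proof.
move=> r0 e_cvg; pose z0 := r / 2.
have z00 : 0 < z0 by rewrite divr_gt0.
have : cvgn (pseries e z0).
  by apply/cvg_ex; exists 0; apply: e_cvg; rewrite z00 /z0; lra.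
move=> /cvg_series_bounded [M0 [_ /(_ (Num.max 0 M0 + 1))]].
rewrite ltr_pwDr ?le_max ?lexx ?orbT// => /(_ isT) bnd.
pose C := Num.max 0 M0 + 1; have C0 : 0 < C by rewrite ltr_wpDl// le_max lexx.
have eC n : `|e n| * z0 ^+ n <= C.
  have := bnd n I; by rewrite /= normrM normrX (gtr0_norm z00).
have small x : 0 < x <= 2^-1 -> `|e 0%N| <= C * 2 * x.
  move=> /andP[x0 x2].
  have xz : 0 < x * z0 < r.
    rewrite mulr_gt0//= (@le_lt_trans _ _ (2^-1 * z0))// ?ler_wpM2r// ?ltW// /z0.
    by lra.
  have part n : `|pseries e (x * z0) n.+1 - e 0%N| <= C * 2 * x.
    rewrite /pseries /series/= big_nat_recl// expr0 mulr1 [X in `|X|]addrAC subrr add0r.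
    apply: (le_trans (ler_norm_sum _ _ _)).
    apply: (@le_trans _ _ (\sum_(0 <= i < n) (C * x) * x ^+ i)).
      apply: ler_sum => i _; rewrite normrM normrX (@ger0_norm _ (x * z0)) ?(ltW (andP xz).1)//.
      rewrite exprMn mulrCA [leRHS](_ : _ = x ^+ i.+1 * C); last by rewrite exprS; ring.
      by rewrite ler_wpM2l ?exprn_ge0 ?(ltW x0)//; exact: eC.
    have Cx0 : 0 <= C * x by rewrite mulr_ge0// ltW.
    have x1 : `|x| < 1 by rewrite gtr0_norm//; lra.
    apply: (le_trans (geometric_le_lim n Cx0 x0 x1)).
    rewrite ler_pdivrMr; last by lra.
    have : 0 <= C * x * (1 - 2 * x) by rewrite mulr_ge0//; lra.
    by lra.
  have lim0 : `|pseries e (x * z0) n.+1 - e 0%N| @[n --> \oo] --> `|0 - e 0%N|.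
    apply: cvg_norm; apply: cvgB; last exact: cvg_cst.
    by have := e_cvg _ xz; rewrite -cvg_shiftS.
  move: lim0; rewrite sub0r normrN => lim0.
  by rewrite -(cvg_lim _ lim0)//; apply: limr_le; [apply/cvgP: lim0 |
    exact: nearW].
apply/eqP; rewrite -normr_le0 leNgt; apply/negP => e0.
(* At this x the bound 2 C x is at most half of |e 0|, which contradicts e 0 <> 0. *)
pose x := Num.min (2^-1) (`|e 0%N| / (4 * C)).
have x0 : 0 < x by rewrite lt_min invr_gt0 ltr0n/= divr_gt0// mulr_gt0.
have xe : x <= `|e 0%N| / (4 * C) by rewrite ge_min lexx orbT.
have := small x; rewrite x0 ge_min lexx => /(_ isT).
move: xe; rewrite ler_pdivlMr ?mulr_gt0//; lra.
Qed.

(** The series of differences vanishes on ]0, r[. Dividing it by z exposes the first coefficient as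
    a constant term, and dividing once more exposes the second. *)
Lemma cumulant_series_coef (c1 c2 : nat -> R) (F : R -> R) r : 0 < r ->
  (forall z, `|z| < r ->
    (fun n => \sum_(1 <= k < n) c1 k * (z ^+ k / k`!%:R)) @ \oo --> F z) ->
  (forall z, `|z| < r ->
    (fun n => \sum_(1 <= k < n) c2 k * (z ^+ k / k`!%:R)) @ \oo --> F z) ->
  c1 1%N = c2 1%N /\ c1 2 = c2 2.
Proof.
move=> r0 h1 h2.
pose e k := (c1 k.+1 - c2 k.+1) / k.+1`!%:R.
have e_cvg z : 0 < z < r -> pseries e z @ \oo --> 0.
  move=> /andP[z0 zr].
  have zr' : `|z| < r by rewrite gtr0_norm.
  have : (fun n => \sum_(1 <= k < n) c1 k * (z ^+ k / k`!%:R)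
     - \sum_(1 <= k < n) c2 k * (z ^+ k / k`!%:R)) @ \oo --> 0.
    by rewrite -[X in _ --> X](subrr (F z)); apply: cvgB; [exact: h1|exact: h2].
  rewrite -cvg_shiftS => H.
  have -> : pseries e z = fun n => z^-1 * (\sum_(1 <= k < n.+1) c1 k * (z ^+ k / k`!%:R)
     - \sum_(1 <= k < n.+1) c2 k * (z ^+ k / k`!%:R)).
    apply/funext => n; rewrite /pseries /series/= -sumrB big_add1/= mulr_sumr.
    apply: eq_bigr => i _; rewrite /e exprS.
    by field; rewrite pnatr_eq0 -lt0n fact_gt0 gt_eqF.
  rewrite -[X in _ --> X](mulr0 z^-1). apply: cvgMl_tmp. exact: H.
have e0 := pseries_eq0_coef0 r0 e_cvg.
have e1 : e 1%N = 0.
  apply: (@pseries_eq0_coef0 (fun n => e n.+1) r r0) => z zr.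
  have z0 : 0 < z by case/andP: zr.
  have -> : pseries (fun n => e n.+1) z = fun n => z^-1 * pseries e z n.+1.
    apply/funext => n; rewrite /pseries /series/= [in RHS]big_nat_recl// e0 mul0r add0r mulr_sumr.
    by apply: eq_bigr => i _; rewrite exprS; field; rewrite gt_eqF.
  rewrite -[X in _ --> X](mulr0 z^-1); apply: cvgMl_tmp.
  by have := e_cvg _ zr; rewrite -cvg_shiftS.
move: e0 e1; rewrite /e => /eqP; rewrite mulf_eq0 invr_eq0 pnatr_eq0 orbF subr_eq0 => /eqP ->.
by move=> /eqP; rewrite mulf_eq0 invr_eq0 pnatr_eq0 orbF subr_eq0 => /eqP ->.
Qed.

End power_series.

(** * The binomial series of the square root *)

Section sqrt_series.
Context {R : realType}.

(* Taylor coefficients of [sqrt (1 - u)] at [0]. *)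
Fixpoint sqrt_coef (n : nat) : R :=
  if n is n'.+1 then sqrt_coef n' * (n'%:R - 2^-1) / n%:R else 1.

Lemma sqrt_coefS n : n.+1%:R * sqrt_coef n.+1 = sqrt_coef n * (n%:R - 2^-1).
Proof. by rewrite /= mulrC divfK// pnatr_eq0. Qed.

Lemma sqrt_coef_le1 n : `|sqrt_coef n| <= 1.
Proof.
elim: n => [|n IH]; first by rewrite normr1.
rewrite [sqrt_coef _]/= !normrM normfV ler_pdivrMr ?normr_gt0 ?pnatr_eq0// mul1r.
rewrite -[leRHS]mul1r ler_pM// (ger0_norm (ler0n _ _)) ler_norml.
have := ler0n R n; rewrite -natr1; lra.
Qed.

Definition sqrt_series (x : R) : R := limn (pseries sqrt_coef x).

Lemma is_cvg_sqrt_series x : `|x| < 4^-1 -> cvgn (pseries sqrt_coef x).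
Proof.
move=> x4; apply: (@is_cvg_pseries_inside _ _ (4^-1)); last first.
  by rewrite (@ger0_norm _ (4^-1)).
apply: (@is_cvg_pseries_geometric_bound _ _ 1) => n; rewrite mul1r.
by apply: (le_trans (sqrt_coef_le1 n)); rewrite exprn_ege1// ler1n.
Qed.

(** The recurrence of the coefficients is the differential equation (1 - x) f' = - f / 2 of sqrt (1
    - x), read termwise. *)
Lemma is_derive_sqrt_series (x : R) : `|x| < 4^-1 ->
  exists2 f', is_derive x (1 : R) sqrt_series f' &
    (1 - x) * f' = - sqrt_series x / 2.
Proof.
move=> x4.
have n2 n : n%:R <= 2 ^+ n :> R.
  by rewrite -natrX ler_nat ltnW// ltn_expl.
pose d1 := pseries_diffs sqrt_coef; pose d2 := pseries_diffs d1.
have d1E n : d1 n = sqrt_coef n * (n%:R - 2^-1) by rewrite -sqrt_coefS.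
have c0 : cvgn (pseries sqrt_coef (4^-1)).
  apply: (@is_cvg_pseries_geometric_bound _ _ 1) => n; rewrite mul1r.
  by apply: (le_trans (sqrt_coef_le1 n)); rewrite exprn_ege1// ler1n.
have d1b n : `|d1 n| <= n.+1%:R.
  rewrite d1E normrM -[leRHS]mul1r ler_pM// ?sqrt_coef_le1// ler_norml.
  by have := ler0n R n; rewrite -natr1; lra.
have c1 : cvgn (pseries d1 (4^-1)).
  apply: (@is_cvg_pseries_geometric_bound _ _ 2) => n.
  by apply: (le_trans (d1b n)); rewrite -exprS.
have c2 : cvgn (pseries d2 (4^-1)).
  apply: (@is_cvg_pseries_geometric_bound _ _ 6) => n.
  rewrite /d2 /pseries_diffs normrM (ger0_norm (ler0n _ _)).
  apply: (@le_trans _ _ (n.+1%:R * n.+2%:R)); first by rewrite ler_wpM2l.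
  elim: n => [|n IH]; first by rewrite expr0 mulr1 -natrM ler_nat.
  rewrite exprS.
  have [->|[->|n2']] : n = 0%N \/ n = 1%N \/ (1 < n)%N.
    by case: n {IH} => [|[|n]]; auto.
  - by rewrite expr0 mulr1 -!natrM ler_nat.
  - by rewrite expr1 -!natrM ler_nat.
  - have : 2 <= n%:R :> R by rewrite ler_nat.
    move: IH; rewrite -!natr1; nra.
have x4' : `|x| < `|4^-1 : R| by rewrite (@ger0_norm _ (4^-1)).
exists (limn (pseries d1 x)); first exact: pseries_snd_diffs c0 c1 c2 x4'.
have cx := is_cvg_sqrt_series x4.
have c1x : cvgn (pseries d1 x) := is_cvg_pseries_inside c1 x4'.
have H := pseries_diffs_equiv c1x.
(* By the recurrence the n-th coefficient of f' is n c_n - c_n / 2; the first part sums to x f', the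
   second to f / 2. *)
have eqL : limn (pseries d1 x) = x * limn (pseries d1 x) - sqrt_series x / 2.
  apply: cvg_lim => //.
  rewrite [X in X @ _ --> _](_ : _ = fun n =>
      x * (series (fun i => i%:R * sqrt_coef i * x ^+ i.-1) n)
      - pseries sqrt_coef x n / 2); last first.
    apply/funext => n; rewrite /pseries /series/= mulr_sumr mulr_suml -sumrB.
    apply: eq_bigr => -[|i] _; rewrite d1E ?expr0 ?mul0r ?mulr0; first by ring.
    by rewrite exprS/=; ring.
  apply: cvgB; first by apply: cvgMl_tmp; exact: H.
  by apply: cvgMr_tmp.
by rewrite mulrBl mul1r {1}eqL; ring.
Qed.

Lemma sqrt_series0 : sqrt_series 0 = 1.
Proof.
apply/cvg_lim => //; rewrite -cvg_shiftS.
rewrite [X in X @ _](_ : _ = cst 1); first exact: cvg_cst.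
apply/funext => n; rewrite /pseries /series/= big_nat_recl// expr0 mulr1.
by rewrite big1 ?addr0// => i _; rewrite expr0n mulr0.
Qed.

Lemma is_derive0_cst_ball (g : R -> R) r : 0 < r ->
  (forall x, `|x| < r -> is_derive x (1 : R) g 0) ->
  forall x, `|x| < r -> g x = g 0.
Proof.
move=> r0 dg x xr.
have cst_on a b : a <= b -> - r < a -> b < r -> g a = g b.
  move=> ab ra br.
  have [||c _] := @MVT_segment R g (cst 0) a b ab.
  - move=> y; rewrite in_itv/= => /andP[ay yb]; apply: dg.
    by rewrite ltr_norml (lt_trans ra)//= (lt_trans yb).
  - apply: continuous_in_subspaceT => y; rewrite inE/= in_itv/= => /andP[ay yb].
    apply: differentiable_continuous; apply/derivable1_diffP.
    have yr : `|y| < r by rewrite ltr_norml (lt_le_trans ra)//= (le_lt_trans yb).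
    exact: (@ex_derive _ _ _ _ _ _ _ (dg _ yr)).
  - by rewrite mul0r => /eqP; rewrite subr_eq0 => /eqP.
move: xr; rewrite ltr_norml => /andP[rx xr].
have [x0|x0] := leP 0 x.
  by rewrite (cst_on 0 x)// oppr_lt0.
by rewrite (cst_on x 0)// ltW.
Qed.

(** The quotient of the series by sqrt (1 - y), written with [expR] and [ln], has derivative zero by
    the differential equation, and its value at 0 is 1. *)
Lemma sqrt_seriesE (x : R) : `|x| < 4^-1 -> sqrt_series x = Num.sqrt (1 - x).
Proof.
have r0 : 0 < 4^-1 :> R by rewrite invr_gt0.
pose g y := sqrt_series y * expR (- (ln (1 - y) / 2)).
have dg y : `|y| < 4^-1 -> is_derive y (1 : R) g 0.
  move=> y4; have [f' df eqf] := is_derive_sqrt_series y4.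
  have y1 : 0 < 1 - y by move: y4; rewrite ltr_norml; lra.
  have dln := is_derive1_ln y1.
  apply: trigger_derive.
  rewrite /GRing.scale/=.
  have -> : f' = - sqrt_series y / 2 / (1 - y).
    by rewrite -eqf mulrC mulKf// gt_eqF.
  by field; rewrite gt_eqF.
move=> x4; have := is_derive0_cst_ball r0 dg x4.
have x1 : 0 < 1 - x by move: x4; rewrite ltr_norml; lra.
rewrite /g sqrt_series0 subr0 ln1 mul0r oppr0 expR0 mulr1 expRN => /divr1_eq ->.
by rewrite -powR12_sqrt ?ltW// /powR gt_eqF// mulrC.
Qed.

End sqrt_series.

(** * Exponential martingales of Brownian motion with drift *)

Section brownian_motion_with_drift.
Context {d : measure_display} {Omega : measurableType d} {R : realType}.
Context {P : probability Omega R} (W : R -> {RV P >-> R}).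
Hypothesis hW : standard_brownian_motion W.

Lemma bm_indep_ge0M (s t : R) (Z : {RV P >-> R}) (f : R -> \bar R) :
  0 <= s -> s < t ->
  (forall B : set R, measurable B -> past W s (Z @^-1` B)) ->
  (forall w, 0 <= Z w) -> measurable_fun setT f -> (forall x, 0 <= f x)%E ->
  (\int[P]_w ((Z w)%:E * f (W t w - W s w)%R)
   = \int[P]_w (Z w)%:E * \int[P]_w f (W t w - W s w)%R)%E.
Proof.
move=> s0 st Zpast Z0 mf f0.
(* The product formula asks for a function nonnegative on all of R, not only on the range of Z, so
   the positive part stands in for the identity. *)
have ZE w : Num.max (Z w) 0 = Z w by apply/max_idPl.
under [LHS]eq_integral => w _ do rewrite -(ZE w).
under [X in (_ = X * _)%E]eq_integral => w _ do rewrite -(ZE w).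
apply: (@indep_ge0_expectationM _ _ _ P Z (W t \- W s)%R
  (fun x => (Num.max x 0)%:E) f) => //.
- move=> A B mA mB; exact: (bm_indep hW s0 st (Zpast A mA) mB).
- by apply/measurable_EFinP; apply: measurable_maxr.
- by move=> x; rewrite lee_fin le_max lexx orbT.
Qed.

Lemma bm_increment_mgf (s t q : R) : 0 <= s -> s < t ->
  (\int[P]_w (expR (q * (W t w - W s w)))%:E
   = (expR (q ^+ 2 * (t - s) / 2))%:E)%E.
Proof.
move=> s0 st.
have mexp : measurable_fun setT (fun x : R => (expR (q * x))%:E).
  by apply/measurable_EFinP; apply: measurableT_comp => //; exact: measurable_funM.
(* [normal_prob] lives on [measurableTypeR R], whose display differs from the
   one of the canonical structure of [R]. *)
pose D : Omega -> measurableTypeR R := fun w => W t w - W s w.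
have mD : measurable_fun setT D by exact: measurable_funB.
transitivity (\int[pushforward P D]_x (expR (q * x))%:E)%E.
  by rewrite ge0_integral_pushforward// preimage_setT.
transitivity (\int[normal_prob 0 (Num.sqrt (t - s))]_x (expR (q * x))%:E)%E.
  by apply: eq_measure_integral => B mB _; exact: (bm_normal hW s0 st mB).
have ts : 0 < t - s by rewrite subr_gt0.
rewrite normal_mgf ?gt_eqF ?sqrtr_gt0// sqr_sqrtr ?ltW//.
by congr (expR _)%:E; ring.
Qed.

Definition drifted (m t : R) (w : Omega) : R := m * t + W t w.

Definition cgf (m q : R) : R := q ^+ 2 / 2 + m * q.

Definition exp_mart (m q t : R) (w : Omega) : R :=
  expR (q * drifted m t w - cgf m q * t).

Lemma measurable_drifted m t : measurable_fun setT (drifted m t).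
Proof. exact: measurable_funD. Qed.

Lemma measurable_exp_mart m q t : measurable_fun setT (exp_mart m q t).
Proof.
apply: measurableT_comp => //; apply: measurable_funB => //.
by apply: measurable_funM => //; exact: measurable_drifted.
Qed.

(** The past is handled as the measurable sets of a generated sigma-algebra type, so that membership
    in [past W s] follows from the closure properties of measurable functions. *)
Lemma past_measurable_fun (s u : R) : 0 <= u <= s ->
  measurable_fun (setT : set (g_sigma_algebraType
    (\bigcup_(u in `[0, s]) preimage_set_system [set: Omega] (W u) measurable)))
    (W u).
Proof.
move=> us _ B mB; rewrite setTI; apply: sub_sigma_algebra.
exists u; first by rewrite /= in_itv.
by exists B => //; rewrite setTI.
Qed.

(** The martingale property, tested on an event of the past: the value at t is the value at s times
    a function of the increment that is independent of the past and has mean one. *)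
Lemma exp_mart_step (m q s t : R) (A : set Omega) : 0 <= s -> s < t ->
  measurable A -> past W s A ->
  (\int[P]_w (\1_A w * exp_mart m q t w)%:E
   = \int[P]_w (\1_A w * exp_mart m q s w)%:E)%E.
Proof.
move=> s0 st mA pA.
pose Zf w := \1_A w * exp_mart m q s w.
have mZ : measurable_fun setT Zf.
  by apply: measurable_funM; [exact: measurable_indic|exact: measurable_exp_mart].
pose Z : {mfun Omega >-> R} := HB.pack Zf (isMeasurableFun.Build _ _ _ _ Zf mZ).
have Zpast B : measurable B -> past W s (Z @^-1` B).
  have mZ' : measurable_fun (setT : set (g_sigma_algebraType
    (\bigcup_(u in `[0, s]) preimage_set_system [set: Omega] (W u) measurable))) Zf.
    apply: measurable_funM; first exact: measurable_indic.
    apply: measurableT_comp => //; apply: measurable_funB => //.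
    apply: measurable_funM => //; apply: measurable_funD => //.
    by apply: past_measurable_fun; rewrite s0 lexx.
  by move=> mB; have := mZ' measurableT B mB; rewrite setTI.
have Z0 w : 0 <= Z w by rewrite /= mulr_ge0// expR_ge0.
have mexp : measurable_fun setT
    (fun x : R => (expR (q * (m * (t - s) + x) - cgf m q * (t - s)))%:E).
  apply/measurable_EFinP; apply: measurableT_comp => //; apply: measurable_funB => //.
  by apply: measurable_funM => //; exact: measurable_funD.
transitivity (\int[P]_w ((Z w)%:E *
    (expR (q * (m * (t - s) + (W t w - W s w)) - cgf m q * (t - s)))%:E))%E.
  apply: eq_integral => w _; rewrite -EFinM /= /Zf -mulrA; congr (_ * _)%:E.
  rewrite /exp_mart /drifted -expRD; congr expR; ring.
rewrite (@bm_indep_ge0M s t Z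
  (fun x => (expR (q * (m * (t - s) + x) - cgf m q * (t - s)))%:E) s0 st)//.
rewrite [X in (_ * X)%E](_ : _ = 1%E) ?mule1//.
transitivity (\int[P]_w ((expR (q * (m * (t - s)) - cgf m q * (t - s)))%:E *
    (expR (q * (W t w - W s w)))%:E))%E.
  by apply: eq_integral => w _; rewrite -EFinM -expRD; congr (expR _)%:E; ring.
rewrite ge0_integralZl//.
- rewrite bm_increment_mgf// -EFinM -expRD /cgf -[RHS]/(1%:E) -expR0.
  by congr (expR _)%:E; field.
- apply/measurable_EFinP; apply: measurableT_comp => //.
  by apply: measurable_funM => //; exact: measurable_funB.
Qed.

Lemma exp_mart0 m q : (\int[P]_w (exp_mart m q 0 w)%:E = 1)%E.
Proof.
transitivity (\int[P]_w cst 1%E w)%E; last first.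
  by rewrite integral_cst// mul1e; exact: probability_setT.
apply: ae_eq_integral => //.
- by apply/measurable_EFinP; exact: measurable_exp_mart.
- apply: filterS (bm_start hW) => w W0 _ .
  by rewrite /exp_mart /drifted W0 !mulr0 addr0 mulr0 subr0 expR0.
Qed.

Lemma exp_mart_mean m q t : 0 <= t -> (\int[P]_w (exp_mart m q t w)%:E = 1)%E.
Proof.
rewrite le_eqVlt => /predU1P[<-|t0]; first exact: exp_mart0.
rewrite -(exp_mart0 m q).
have ext u : (\int[P]_w (exp_mart m q u w)%:E
            = \int[P]_w (\1_setT w * exp_mart m q u w)%:E)%E.
  by apply: eq_integral => w _; rewrite indicT mul1r.
rewrite !ext (exp_mart_step _ _ _ t0)//.
exact: (@measurableT _ (g_sigma_algebraType
    (\bigcup_(u in `[0, 0]) preimage_set_system [set: Omega] (W u) measurable))).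
Qed.

Lemma drifted_mgf m q t : 0 <= t ->
  (\int[P]_w (expR (q * drifted m t w))%:E = (expR (cgf m q * t))%:E)%E.
Proof.
move=> t0; rewrite -[RHS]mule1 -(exp_mart_mean m q t0) -ge0_integralZl//.
- by apply: eq_integral => w _; rewrite -EFinM -expRD; congr (expR _)%:E; ring.
- by apply/measurable_EFinP; exact: measurable_exp_mart.
- by move=> w _; rewrite lee_fin expR_ge0.
Qed.

Lemma drifted_increment_mgf m q s t : 0 <= s -> s < t ->
  (\int[P]_w (expR (q * (drifted m t w - drifted m s w)))%:E
   = (expR (cgf m q * (t - s)))%:E)%E.
Proof.
move=> s0 st.
transitivity (\int[P]_w ((expR (q * m * (t - s)))%:E *
    (expR (q * (W t w - W s w)))%:E))%E.
  by apply: eq_integral => w _; rewrite -EFinM -expRD /drifted; congr (expR _)%:E; ring.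
rewrite ge0_integralZl//.
- rewrite bm_increment_mgf// -EFinM -expRD /cgf; congr (expR _)%:E; ring.
- apply/measurable_EFinP; apply: measurableT_comp => //.
  by apply: measurable_funM => //; exact: measurable_funB.
Qed.

End brownian_motion_with_drift.

(** * Optional stopping on a grid *)

Section grid_crossing.
Context {T : Type} {R : realType}.
Implicit Types (x : nat -> T -> R) (h : R).

Definition below x h K : set T := [set w | forall j, (j <= K)%N -> x j w <= h].

(* The first index at which [x] exceeds [h] is [k.+1]. *)
Definition crossing x h k : set T := [set w | below x h k w /\ h < x k.+1 w].

Lemma belowS x h K : below x h K.+1 = below x h K `&` [set w | x K.+1 w <= h].
Proof.
apply/seteqP; split => [w bw|w [bw xK] j].
  by split => [j jK|]; apply: bw => //; exact: leqW.
by rewrite leq_eqVlt => /predU1P[->//|]; rewrite ltnS; exact: bw.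
Qed.

Lemma below_split x h K w :
  \1_(below x h K) w = \1_(below x h K.+1) w + \1_(crossing x h K) w :> R.
Proof.
rewrite !indicE belowS.
have [bw|nbw] := boolP (w \in below x h K); last first.
  have -> : (w \in below x h K `&` [set w | x K.+1 w <= h]) = false.
    by apply/negbTE; apply: contra nbw; rewrite !inE => -[].
  have -> : (w \in crossing x h K) = false.
    by apply/negbTE; apply: contra nbw; rewrite !inE => -[].
  by rewrite addr0.
move: bw; rewrite inE => bw; have [xK|xK] := leP (x K.+1 w) h.
  rewrite mem_set//= memNset ?addr0// => -[_].
  by rewrite ltNge xK.
rewrite memNset; last by move=> [_] /=; rewrite leNgt xK.
by rewrite mem_set// add0r.
Qed.

Lemma crossing_inj x h j k w : crossing x h j w -> crossing x h k w -> j = k.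
Proof.
wlog jk : j k / (j < k)%N => [H xj xk|[_ xj] [bk _]].
  by case: (ltngtP j k) => // jk; [exact: H|apply/esym/H].
by have := bk j.+1 jk; rewrite leNgt xj.
Qed.

Lemma crossing_exists x h n w : x 0%N w <= h -> h < x n w ->
  exists2 k, (k < n)%N & crossing x h k w.
Proof.
move=> x0 xn; have ex : exists n, h < x n w by exists n.
case: (ex_minnP ex) => -[|k] xk mk; first by rewrite ltNge x0 in xk.
exists k; first exact: mk.
split=> // j jk; rewrite leNgt; apply/negP => /mk.
by rewrite ltnNge jk.
Qed.

End grid_crossing.

Lemma measurable_below {d} {T : measurableType d} {R : realType}
    (x : nat -> T -> R) h K :
  (forall j, (j <= K)%N -> measurable_fun setT (x j)) -> measurable (below x h K).
Proof.
move=> mx.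
have mle j : (j <= K)%N -> measurable [set w | x j w <= h].
  move=> /mx mxj; rewrite -[X in measurable X]setTI.
  exact: measurable_fun_le.
elim: K mx mle => [|K IH] mx mle.
  rewrite (_ : below x h 0 = [set w | x 0%N w <= h]); first exact: mle.
  by apply/seteqP; split => w /=; [exact|move=> x0 j; rewrite leqn0 => /eqP ->].
rewrite belowS; apply: measurableI; last exact: mle.
by apply: IH => j jK; [apply: mx|apply: mle]; exact: leqW.
Qed.

Lemma measurable_crossing {d} {T : measurableType d} {R : realType}
    (x : nat -> T -> R) h k :
  (forall j, measurable_fun setT (x j)) -> measurable (crossing x h k).
Proof.
move=> mx; apply: measurableI; first exact: measurable_below.
rewrite [X in measurable X](_ : _ = ~` (setT `&` [set w | x k.+1 w <= h])); last first.
  by rewrite setTI; apply/seteqP; split=> w /=; rewrite ltNge => /negP.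
by apply: measurableC; exact: measurable_fun_le.
Qed.

Section stopped_exponential_martingale.
Context {d : measure_display} {Omega : measurableType d} {R : realType}.
Context {P : probability Omega R} (W : R -> {RV P >-> R}).
Hypothesis hW : standard_brownian_motion W.
Variables m h : R.
Hypothesis h_gt0 : 0 < h.

Definition grid (delta : R) (k : nat) : Omega -> R := drifted W m (k%:R * delta).

Lemma measurable_grid delta k : measurable_fun setT (grid delta k).
Proof. exact: measurable_drifted. Qed.

Lemma grid_start delta : {ae P, forall w, grid delta 0 w = 0}.
Proof.
by apply: filterS (bm_start hW) => w; rewrite /grid /drifted mul0r mulr0 add0r.
Qed.

(** Induction on K. The paths below h up to step K are an event of the past, so the martingale may
    be advanced by one step on it; that event then splits according to whether h is exceeded at step
    K + 1. At K = 0 it has probability one, as X starts at 0 < h. *)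
Lemma optional_stopping q delta K : 0 < delta ->
  (\sum_(k < K) \int[P]_w (\1_(crossing (grid delta) h k) w
                           * exp_mart W m q (k.+1%:R * delta) w)%:E
   + \int[P]_w (\1_(below (grid delta) h K) w
                 * exp_mart W m q (K%:R * delta) w)%:E = 1)%E.
Proof.
move=> d0.
have mb k : measurable (below (grid delta) h k).
  by apply: measurable_below => j _; exact: measurable_grid.
have mc k : measurable (crossing (grid delta) h k).
  by apply: measurable_crossing => j; exact: measurable_grid.
have mM (A : set Omega) t : measurable A ->
    measurable_fun setT (fun w => (\1_A w * exp_mart W m q t w)%:E).
  move=> mA; apply/measurable_EFinP; apply: measurable_funM => //.
  exact: measurable_exp_mart.
elim: K => [|K IH].
  rewrite big_ord0 add0e -(exp_mart0 hW m q) mul0r.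
  apply: ae_eq_integral => //.
  - exact: mM.
  - by apply/measurable_EFinP; exact: measurable_exp_mart.
  - apply: filterS (grid_start delta) => w w0 _; congr EFin.
    rewrite indicE mem_set ?mul1r// => j; rewrite leqn0 => /eqP ->.
    by rewrite w0 ltW.
rewrite -[RHS]IH big_ord_recr/= -addeA; congr (_ + _)%E.
have s0 : 0 <= K%:R * delta by rewrite mulr_ge0// ltW.
have st : K%:R * delta < K.+1%:R * delta by rewrite ltr_pM2r// ltr_nat.
rewrite -(exp_mart_step hW m q s0 st (mb K)); last first.
  apply: (@measurable_below _ (g_sigma_algebraType
    (\bigcup_(u in `[0, K%:R * delta])
       preimage_set_system [set: Omega] (W u) measurable))) => j jK.
  apply: measurable_funD => //; apply: past_measurable_fun.
  by rewrite mulr_ge0 ?(ltW d0)//= ler_pM2r// ler_nat.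
rewrite -ge0_integralD//=; last 4 first.
- by move=> w _; rewrite lee_fin mulr_ge0// expR_ge0.
- exact: mM.
- by move=> w _; rewrite lee_fin mulr_ge0// expR_ge0.
- exact: mM.
apply: eq_integral => w _; by rewrite -EFinD -mulrDl (below_split _ _ K) addrC.
Qed.

(* Exponential Markov bound: [1 <= expR (eta * (h - X))] where [X <= h]. *)
Lemma below_tail q eta delta K : 0 <= eta -> 0 < delta ->
  (\int[P]_w (\1_(below (grid delta) h K) w
                 * exp_mart W m q (K%:R * delta) w)%:E
   <= (expR (eta * h - eta * (q + m - eta / 2) * (K%:R * delta)))%:E)%E.
Proof.
move=> eta0 d0; pose t := K%:R * delta.
have t0 : 0 <= t by rewrite mulr_ge0// ltW.
have -> : expR (eta * h - eta * (q + m - eta / 2) * t) =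
   expR (eta * h - cgf m q * t) * expR (cgf m (q - eta) * t).
  by rewrite -expRD /cgf; congr expR; field.
rewrite EFinM -(drifted_mgf hW m (q - eta) t0) -ge0_integralZl//; last first.
  apply/measurable_EFinP; apply: measurableT_comp => //.
  by apply: measurable_funM => //; exact: measurable_drifted.
apply: ge0_le_integral => //.
- by move=> w _; rewrite lee_fin mulr_ge0// expR_ge0.
- apply/measurable_EFinP; apply: measurable_funM; last exact: measurable_exp_mart.
  apply: measurable_indic; apply: measurable_below => j _; exact: measurable_grid.
- apply/measurable_EFinP; apply: measurable_funM => //; apply: measurableT_comp => //.
  by apply: measurable_funM => //; exact: measurable_drifted.
move=> w _; rewrite -EFinM lee_fin -expRD indicE.
have [|_] := boolP (w \in _); last by rewrite mul0r expR_ge0.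
rewrite inE mul1r => /(_ K (leqnn K)); rewrite /grid -/t => Xh.
rewrite ler_expR -subr_ge0 [leRHS](_ : _ = eta * (h - drifted W m t w)); last by ring.
by rewrite mulr_ge0// subr_ge0.
Qed.

(* Capping [X] at [h + 1] makes the stopped process dominated; the error is
   controlled by the overshoot over [h], which is at most one increment. *)
Definition truncated_mart q t w :=
  expR (q * Num.min (drifted W m t w) (h + 1) - cgf m q * t).

Lemma measurable_truncated_mart q t : measurable_fun setT (truncated_mart q t).
Proof.
apply: measurableT_comp => //; apply: measurable_funB => //.
apply: measurable_funM => //; apply: measurable_minr => //.
exact: measurable_drifted.
Qed.

(* Where the two processes differ the increment exceeds 1, hence the factor
   [expR (lambda * (increment - 1))]. *)
Lemma overshoot_pointwise q delta k lambda w : 0 < delta -> 0 <= lambda ->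
  \1_(crossing (grid delta) h k) w *
     `|exp_mart W m q (k.+1%:R * delta) w - truncated_mart q (k.+1%:R * delta) w|
  <= expR (`|q| * h - lambda + `|cgf m q| * (k.+1%:R * delta))
     * expR ((`|q| + lambda) * (grid delta k.+1 w - grid delta k w)).
Proof.
move=> d0 l0; rewrite indicE; have [|_] := boolP (w \in _); last first.
  by rewrite mul0r mulr_ge0 ?expR_ge0.
rewrite inE mul1r => -[/(_ k (leqnn k)) xk xk1].
rewrite /exp_mart /truncated_mart -/(grid delta k.+1 w).
set t := k.+1%:R * delta; have t0 : 0 <= t by rewrite mulr_ge0// ltW.
set x := grid delta k.+1 w in xk1 *; set y := grid delta k w in xk *.
have [xh|xh] := leP x (h + 1).
  by rewrite subrr normr0 mulr_ge0 ?expR_ge0.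
rewrite -expRD.
(* One bound for every level u between h and x covers both u = x and u = h + 1, and a common bound
   of two nonnegative numbers bounds their distance. It uses y <= h and x - y > 1. *)
have le1 u : h <= u -> u <= x -> expR (q * u - cgf m q * t) <=
    expR (`|q| * h - lambda + `|cgf m q| * t + (`|q| + lambda) * (x - y)).
  move=> hu ux; rewrite ler_expR.
  have : - cgf m q * t <= `|cgf m q| * t.
    by rewrite ler_wpM2r// -normrN ler_norm.
  have : q * u <= `|q| * u by rewrite ler_wpM2r ?ler_norm// (le_trans _ hu)// ltW.
  have : `|q| * u <= `|q| * (h + (x - y)) by rewrite ler_wpM2l//; lra.
  have : lambda * 1 <= lambda * (x - y) by rewrite ler_wpM2l//; lra.
  lra.
have h1 : h <= h + 1 by rewrite lerDl.
have b1 := le1 x (ltW xk1) (lexx x).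
have b2 := le1 (h + 1) h1 (ltW xh).
by rewrite ler_norml; apply/andP; split; have := expR_ge0 (q * x - cgf m q * t);
  have := expR_ge0 (q * (h + 1) - cgf m q * t); lra.
Qed.

Lemma overshoot q delta k lambda : 0 < delta -> 0 <= lambda ->
  (\int[P]_w (\1_(crossing (grid delta) h k) w *
     `|exp_mart W m q (k.+1%:R * delta) w - truncated_mart q (k.+1%:R * delta) w|)%:E
  <= (expR (`|q| * h - lambda + `|cgf m q| * (k.+1%:R * delta)
            + cgf m (`|q| + lambda) * delta))%:E)%E.
Proof.
move=> d0 l0.
have s0 : 0 <= k%:R * delta by rewrite mulr_ge0// ltW.
have st : k%:R * delta < k.+1%:R * delta by rewrite ltr_pM2r// ltr_nat.
have mX : measurable_fun setT (fun w => (expR ((`|q| + lambda) *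
    (grid delta k.+1 w - grid delta k w)))%:E).
  apply/measurable_EFinP; apply: measurableT_comp => //.
  by apply: measurable_funM => //; apply: measurable_funB; exact: measurable_grid.
rewrite expRD EFinM.
have -> : cgf m (`|q| + lambda) * delta =
  cgf m (`|q| + lambda) * (k.+1%:R * delta - k%:R * delta).
  by rewrite -mulrBl -natr1 [_ + 1 - _]addrAC subrr add0r mul1r.
rewrite -(drifted_increment_mgf hW m (`|q| + lambda) s0 st) -ge0_integralZl//.
apply: ge0_le_integral => //.
- apply/measurable_EFinP; apply: measurable_funM.
    by apply: measurable_indic; apply: measurable_crossing => j; exact: measurable_grid.
  apply: measurableT_comp => //; apply: measurable_funB.
    exact: measurable_exp_mart.
  exact: measurable_truncated_mart.
- exact: measurable_funeM.
- by move=> w _; rewrite -EFinM lee_fin; exact: overshoot_pointwise.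
Qed.

End stopped_exponential_martingale.

(** * The mean of the capped martingale at the grid crossing *)

Section truncated_mean.
Context {d : measure_display} {Omega : measurableType d} {R : realType}.
Context {P : probability Omega R} (W : R -> {RV P >-> R}).
Hypothesis hW : standard_brownian_motion W.
Variables m h q : R.
Hypotheses (m_gt0 : 0 < m) (h_gt0 : 0 < h) (q_small : `|q| <= m / 2).
Hypothesis cgf_half : `|cgf m q| <= 2^-1.

Definition mesh n : R := 4^-1 ^+ n.
Definition steps n : nat := (n * 4 ^ n)%N.

Lemma mesh_gt0 n : 0 < mesh n.
Proof. by rewrite exprn_gt0// invr_gt0. Qed.

Lemma steps_mesh n : (steps n)%:R * mesh n = n%:R.
Proof. by rewrite /steps /mesh natrM natrX exprVn mulfK// expf_neq0. Qed.

Lemma mesh_steps n k : (k < steps n)%N -> k.+1%:R * mesh n <= n%:R.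
Proof. by move=> kn; rewrite -(steps_mesh n) ler_pM2r ?mesh_gt0// ler_nat. Qed.

(** At most one of the crossing events occurs, so this is the capped martingale at the first grid
    crossing, and 0 if there is none up to time n. *)
Definition truncated_sum n w := \sum_(k < steps n)
  \1_(crossing (grid W m (mesh n)) h k) w * truncated_mart W m h q (k.+1%:R * mesh n) w.

Lemma measurable_truncated_sum n : measurable_fun setT (truncated_sum n).
Proof.
apply: measurable_sum => k; apply: measurable_funM.
  by apply: measurable_indic; apply: measurable_crossing => j; exact: measurable_grid.
exact: measurable_truncated_mart.
Qed.

(** With l = 2^n, so that the mesh is 1 / l^2, this exponent bounds |q| h + psi (|q| + l) / l^2 for
    every n. *)
Let overshoot_cst : R :=
  expR (`|q| * h + (`|q| ^+ 2 / 2 + `|q| + 2^-1 + m * `|q| + m)).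

(** The Markov parameter is l = 2^n, the inverse of the standard deviation of an increment: the
    increment's exponential moment stays bounded while a factor exp (- l) is gained. Half of it is
    spent on |psi q| n <= l / 2. There are at most l^3 terms, and exp (l / 2) >= (l / 2)^4 / 4!
    leaves 384 / l, with 384 = 4! 2^4. *)
Lemma overshoot_sum n :
  (\sum_(k < steps n) \int[P]_w (\1_(crossing (grid W m (mesh n)) h k) w *
     `|exp_mart W m q (k.+1%:R * mesh n) w
       - truncated_mart W m h q (k.+1%:R * mesh n) w|)%:E
   <= (384 * overshoot_cst * 2^-1 ^+ n)%:E)%E.
Proof.
pose l : R := 2 ^+ n.
have l1 : 1 <= l by rewrite exprn_ege1// ler1n.
have l0 : 0 < l by rewrite (lt_le_trans _ l1).
have nl : n%:R <= l by rewrite /l -natrX ler_nat ltnW// ltn_expl.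
have meshE : mesh n = l ^- 2.
  by rewrite /mesh /l -exprM mulnC exprM -[in RHS]exprVn -natrX.
have term (k : 'I_(steps n)) : (\int[P]_w (\1_(crossing (grid W m (mesh n)) h k) w *
     `|exp_mart W m q (k.+1%:R * mesh n) w
       - truncated_mart W m h q (k.+1%:R * mesh n) w|)%:E
   <= (overshoot_cst * expR (- (l / 2)))%:E)%E.
  apply: (le_trans (overshoot hW m h_gt0 q k (mesh_gt0 n) (ltW l0))).
  rewrite lee_fin -expRD ler_expR.
  have H1 : `|cgf m q| * (k.+1%:R * mesh n) <= 2^-1 * l.
    by rewrite ler_pM ?mulr_ge0// ?(ltW (mesh_gt0 _))// (le_trans (mesh_steps (ltn_ord k))).
  have H2 : cgf m (`|q| + l) * mesh n <= `|q| ^+ 2 / 2 + `|q| + 2^-1 + m * `|q| + m.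
    rewrite meshE ler_pdivrMr ?exprn_gt0// /cgf -subr_ge0.
    rewrite [leRHS](_ : _ = (`|q| ^+ 2 / 2 + m * `|q|) * (l ^+ 2 - 1)
                          + (`|q| + m) * (l * (l - 1))); last by field.
    have l2 : 1 <= l ^+ 2 by rewrite exprn_ege1.
    have m0 := ltW m_gt0.
    have p1 : 0 <= `|q| ^+ 2 / 2 + m * `|q|.
      by rewrite addr_ge0 ?divr_ge0 ?mulr_ge0 ?exprn_ge0.
    have p2 : 0 <= `|q| + m by rewrite addr_ge0.
    have p3 : 0 <= l * (l - 1) by rewrite mulr_ge0 ?(ltW l0)// subr_ge0.
    by rewrite addr_ge0// mulr_ge0// subr_ge0.
  by lra.
apply: (@le_trans _ _ (\sum_(k < steps n) (overshoot_cst * expR (- (l / 2)))%:E)%E).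
  by apply: lee_sum => k _; exact: term.
rewrite sumEFin lee_fin sumr_const card_ord -[leLHS]mulr_natl.
have nsteps : (steps n)%:R <= l ^+ 3.
  rewrite /steps natrM exprS ler_pM// natrX /l -exprM mulnC exprM.
  by rewrite [2 ^+ 2](_ : _ = 4)// -natrX.
have y0 : 0 <= l / 2 by rewrite divr_ge0// ltW.
have := expr_le_factM_expR 3 y0.
rewrite expRN exprVn -/l.
have -> : 4`!%:R = 24 :> R by [].
move=> H; have e0 := expR_gt0 (l / 2).
apply: (@le_trans _ _ (l ^+ 3 * (overshoot_cst / expR (l / 2)))).
  by rewrite ler_wpM2r// divr_ge0// ?expR_ge0.
rewrite [leLHS](_ : _ = overshoot_cst * (l ^+ 3 / expR (l / 2))); last by ring.
rewrite [leRHS](_ : _ = overshoot_cst * (384 / l)); last by ring.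
rewrite ler_wpM2l ?expR_ge0//.
rewrite ler_pdivrMr// mulrAC ler_pdivlMr// -exprSr.
by move: H; rewrite exprMn; lra.
Qed.

(** With eta = m / 2 and |q| <= m / 2 the rate eta (q + m - eta / 2) is at least (m / 2)(m / 4) =
    m^2 / 8, and the elapsed time is n. *)
Lemma below_tail_geometric n :
  (\int[P]_w (\1_(below (grid W m (mesh n)) h (steps n)) w
                 * exp_mart W m q ((steps n)%:R * mesh n) w)%:E
   <= (expR (m / 2 * h) * expR (- (m ^+ 2 / 8)) ^+ n)%:E)%E.
Proof.
have m2 : 0 <= m / 2 by rewrite divr_ge0// ltW.
apply: (le_trans (below_tail hW m h q (steps n) m2 (mesh_gt0 n))).
rewrite lee_fin steps_mesh expRB ler_wpM2l ?expR_ge0// -expRM_natl.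
rewrite -expRN ler_expR mulrN lerN2 mulrC ler_wpM2r ?ler0n//.
have : m ^+ 2 / 8 = m / 2 * (m / 4) by field.
move=> ->; rewrite ler_wpM2l//.
by move: q_small; rewrite ler_norml; lra.
Qed.

(** Optional stopping gives the uncapped mean as 1 minus the tail [u]; capping changes it by at most
    [o], in either direction. Both errors are geometric. *)
Lemma truncated_sum_mean_cvg :
  (\int[P]_w (truncated_sum n w)%:E @[n --> \oo] --> 1)%E.
Proof.
pose o n : R := 384 * overshoot_cst * 2^-1 ^+ n.
pose u n : R := expR (m / 2 * h) * expR (- (m ^+ 2 / 8)) ^+ n.
have mC n k : measurable (crossing (grid W m (mesh n)) h k).
  by apply: measurable_crossing => j; exact: measurable_grid.
pose C n k := \1_(crossing (grid W m (mesh n)) h k) : Omega -> R.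
pose M n k := exp_mart W m q (k.+1%:R * mesh n).
pose N n k := truncated_mart W m h q (k.+1%:R * mesh n).
have mM n k : measurable_fun setT (fun w => (C n k w * M n k w)%:E).
  apply/measurable_EFinP; apply: measurable_funM; last exact: measurable_exp_mart.
  exact: measurable_indic.
have mN n k : measurable_fun setT (fun w => (C n k w * N n k w)%:E).
  apply/measurable_EFinP; apply: measurable_funM; last exact: measurable_truncated_mart.
  exact: measurable_indic.
have mO n k : measurable_fun setT (fun w => (C n k w * `|M n k w - N n k w|)%:E).
  apply/measurable_EFinP; apply: measurable_funM; first exact: measurable_indic.
  apply: measurableT_comp => //; apply: measurable_funB; first exact: measurable_exp_mart.
  exact: measurable_truncated_mart.
have C0 n k w : 0 <= C n k w by rewrite /C.
have M0 n k w : 0 <= M n k w by rewrite expR_ge0.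
have N0 n k w : 0 <= N n k w by rewrite expR_ge0.
have JE n : (\int[P]_w (truncated_sum n w)%:E =
    \sum_(k < steps n) \int[P]_w (C n k w * N n k w)%:E)%E.
  rewrite -ge0_integral_sum//; last by move=> k w _; rewrite lee_fin mulr_ge0.
  by apply: eq_integral => w _; rewrite sumEFin.
have compare n (f g : nat -> Omega -> R) :
    (forall k w, 0 <= f k w) -> (forall k w, 0 <= g k w) ->
    (forall k, measurable_fun setT (fun w => (C n k w * f k w)%:E)) ->
    (forall k, measurable_fun setT (fun w => (C n k w * g k w)%:E)) ->
    (forall k w, f k w - g k w <= `|M n k w - N n k w|) ->
    (\sum_(k < steps n) \int[P]_w (C n k w * f k w)%:E <=
     \sum_(k < steps n) \int[P]_w (C n k w * g k w)%:E + (o n)%:E)%E.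
  move=> f0 g0 mf mg fg.
  apply: (@le_trans _ _ (\sum_(k < steps n) \int[P]_w (C n k w * g k w)%:E
     + \sum_(k < steps n) \int[P]_w (C n k w * `|M n k w - N n k w|)%:E))%E;
    last by rewrite leeD2l// overshoot_sum.
  rewrite -big_split/=; apply: lee_sum => k _.
  rewrite -ge0_integralD//=; last 2 first.
  - by move=> w _; rewrite lee_fin mulr_ge0.
  - by move=> w _; rewrite lee_fin mulr_ge0.
  apply: ge0_le_integral => //.
  - by move=> w _; rewrite lee_fin mulr_ge0.
  - exact: emeasurable_funD.
  - move=> w _; rewrite -EFinD lee_fin -mulrDr ler_wpM2l//.
    by have := fg k w; lra.
have le1 n : (\sum_(k < steps n) \int[P]_w (C n k w * N n k w)%:E <=
    \sum_(k < steps n) \int[P]_w (C n k w * M n k w)%:E + (o n)%:E)%E.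
  by apply: compare => // k w; rewrite distrC ler_norm.
have le2 n : (\sum_(k < steps n) \int[P]_w (C n k w * M n k w)%:E <=
    \sum_(k < steps n) \int[P]_w (C n k w * N n k w)%:E + (o n)%:E)%E.
  by apply: compare => // k w; rewrite ler_norm.
have stop n := optional_stopping hW m h_gt0 q (steps n) (mesh_gt0 n).
have sumM0 n : (0 <= \sum_(k < steps n) \int[P]_w (C n k w * M n k w)%:E)%E.
  by apply: sume_ge0 => k _; apply: integral_ge0 => w _; rewrite lee_fin mulr_ge0.
have U0 n : (0 <= \int[P]_w (\1_(below (grid W m (mesh n)) h (steps n)) w
                 * exp_mart W m q ((steps n)%:R * mesh n) w)%:E)%E.
  by apply: integral_ge0 => w _; rewrite lee_fin mulr_ge0// expR_ge0.
apply: (@squeeze_cvge _ _ _ _ (fun n => (1 - (o n + u n))%:E) _ (fun n => (1 + o n)%:E)).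
- apply: nearW => n; rewrite JE; apply/andP; split.
    rewrite EFinB leeBlDr// -[leLHS](stop n).
    apply: (@le_trans _ _ (\sum_(k < steps n) \int[P]_w (C n k w * N n k w)%:E
        + (o n)%:E + (u n)%:E)%E); last by rewrite EFinD addeA.
    by apply: leeD; [exact: le2|exact: below_tail_geometric].
  apply: (le_trans (le1 n)); rewrite EFinD leeD2r// -[leRHS](stop n).
  by rewrite leeDl.
- apply/cvg_EFin; first exact: nearW.
  rewrite -[X in _ --> X]subr0 -[X in _ --> _ - X]addr0.
  apply: cvgB; first exact: cvg_cst.
  apply: cvgD; apply: cvg_geometric.
    by rewrite ger0_norm ?invr_ge0// invf_lt1// ltr1n.
  by rewrite gtr0_norm ?expR_gt0// -expR0 ltr_expR oppr_lt0 divr_gt0// exprn_gt0.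
- apply/cvg_EFin; first exact: nearW.
  rewrite -[X in _ --> X]addr0.
  apply: cvgD; first exact: cvg_cst.
  apply: cvg_geometric.
  by rewrite ger0_norm ?invr_ge0// invf_lt1// ltr1n.
Qed.

End truncated_mean.

(** * Paths at the first passage *)

Section continuity_halfline.
Context {R : realType}.

Lemma within_halflineP (f : R -> R) : {within `[0, +oo[, continuous f} ->
  forall t e, 0 <= t -> 0 < e ->
  exists2 eta, 0 < eta & forall s, 0 <= s -> `|s - t| < eta -> `|f s - f t| < e.
Proof.
move=> /subspace_continuousP cf t e t0 e0.
have t0' : (`[0, +oo[%classic : set R) t by rewrite /= in_itv/= t0.
have /cvgrPdist_lt /(_ e e0) := cf t t0'.
rewrite /prop_near1 /within/= => /nbhs_ballP[eta/= eta0 H].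
exists eta => // s s0 st; rewrite distrC; apply: H.
  by rewrite /ball/= distrC.
by rewrite in_itv/= s0.
Qed.

End continuity_halfline.

Section first_passage_path.
Context {d : measure_display} {Omega : measurableType d} {R : realType}.
Context {P : probability Omega R} (W : R -> {RV P >-> R}).
Hypothesis hW : standard_brownian_motion W.
Variables m h : R.

Lemma drifted_within (w : Omega) :
  {within `[0, +oo[, continuous (fun t => drifted W m t w)}.
Proof.
have cm : {within (`[0, +oo[%classic : set R), continuous (fun t => m * t)}.
  by apply: continuous_subspaceT; exact: mulrl_continuous.
move=> t; apply: (@continuousD _ _ (subspace (`[0, +oo[%classic : set R))
  (fun t => m * t) (fun t => W t w)); first exact: cm.
exact: bm_continuous hW w t.
Qed.

Lemma drifted_continuous (w : Omega) (t e : R) : 0 <= t -> 0 < e ->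
  exists2 eta, 0 < eta & forall s, 0 <= s -> `|s - t| < eta ->
    `|drifted W m s w - drifted W m t w| < e.
Proof. by move=> t0 e0; exact: (within_halflineP (@drifted_within w) t0 e0). Qed.

Let passage (w : Omega) := [set t : R | 0 <= t /\ h < drifted W m t w].

Lemma mesh_small (e : R) : 0 < e -> \forall n \near \oo, mesh n < e.
Proof.
move=> e0; have : geometric 1 (4^-1 : R) @ \oo --> 0.
  by apply: cvg_geometric; rewrite ger0_norm ?invr_ge0// invf_lt1// ltr1n.
move=> /cvgrPdist_lt /(_ e e0); apply: filterS => n.
by rewrite sub0r normrN /= mul1r ger0_norm// exprn_ge0// invr_ge0.
Qed.

(** By continuity X stays above h on an interval to the right of t, and for a fine mesh the next
    grid point after t falls into it. *)
Lemma grid_passage (w : Omega) (t e : R) : passage w t -> 0 < e ->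
  \forall n \near \oo, exists2 j : nat, t < j%:R * mesh n <= t + e &
     h < grid W m (mesh n) j w.
Proof.
move=> [t0 ht] e0.
have ht' : 0 < drifted W m t w - h by rewrite subr_gt0.
have [eta eta0 H] := drifted_continuous w t0 ht'.
have e1 : 0 < Num.min e (eta / 2) by rewrite lt_min e0 divr_gt0.
near=> n.
have : mesh n < Num.min e (eta / 2) by near: n; exact: mesh_small.
rewrite lt_min => /andP[ne neta].
have n0 := @mesh_gt0 R n.
pose j := (Num.truncn (t / mesh n)).+1.
have tj : t < j%:R * mesh n by rewrite -ltr_pdivrMr// truncnS_gt.
have jt : j%:R * mesh n <= t + mesh n.
  rewrite /j -natr1 mulrDl mul1r lerD2r -ler_pdivlMr//.
  by have /andP[] := truncn_itv (divr_ge0 t0 (ltW n0)).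
exists j; first by rewrite tj/= (le_trans jt)// lerD2l ltW.
have := H (j%:R * mesh n).
rewrite mulr_ge0// ?(ltW n0)// ger0_norm; last by rewrite subr_ge0 ltW.
move=> /(_ isT); have -> : j%:R * mesh n - t < eta by lra.
by move=> /(_ isT); rewrite /grid ltr_norml => /andP[]; lra.
Unshelve. all: by end_near. Qed.

(** A grid crossing is itself a passage, hence not before tau; and it is not later than the grid
    point found just after a passage time t < tau + e. The number of steps suffices once n exceeds t
    + e. *)
Lemma crossing_near (w : Omega) (tau e : R) :
  drifted W m 0 w <= h -> 0 <= tau -> lbound (passage w) tau ->
  (exists2 t, passage w t & t < tau + e) -> 0 < e ->
  \forall n \near \oo, exists k, [/\ (k < steps n)%N,
    crossing (grid W m (mesh n)) h k w & tau <= k.+1%:R * mesh n <= tau + 2 * e].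
Proof.
move=> w0 tau0 lb [t At te] e0; have [t0 _] := At.
near=> n.
have [j /andP[tj jt] hj] : exists2 j : nat, t < j%:R * mesh n <= t + e &
     h < grid W m (mesh n) j w by near: n; exact: grid_passage.
have nt : t + e <= n%:R by near: n; exact: nbhs_infty_ger.
have n0 := @mesh_gt0 R n.
have [|k kj ck] := @crossing_exists _ _ (grid W m (mesh n)) h j w _ hj.
  by rewrite /grid mul0r.
have kj' : k.+1%:R * mesh n <= j%:R * mesh n :> R by rewrite ler_pM2r// ler_nat.
exists k; split => //.
  rewrite -(ltr_nat R) -(ltr_pM2r n0) steps_mesh.
  apply: lt_le_trans nt; apply: lt_le_trans jt.
  by rewrite ltr_pM2r// ltr_nat.
apply/andP; split; last by lra.
apply: lb; split; first by rewrite mulr_ge0// ltW.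
by have [_] := ck.
Unshelve. all: by end_near. Qed.

Lemma first_passage_fin (w : Omega) n0 :
  h < drifted W m n0%:R w -> exists tau : R,
  [/\ first_passage (drifted W m) h w = tau%:E, 0 <= tau, lbound (passage w) tau
    & forall e, 0 < e -> exists2 t, passage w t & t < tau + e].
Proof.
move=> hn0.
have ne : passage w !=set0 by exists n0%:R; split.
have lb0 : lbound (passage w) 0 by move=> t [].
have hl : has_lbound (passage w) by exists 0.
exists (inf (passage w)); split.
- exact: ereal_inf_EFin.
- exact: lb_le_inf.
- by move=> t At; exact: ge_inf.
- by move=> e e0; exact: inf_adherent.
Qed.

(** The two grid points around a crossing lie close to tau, with X <= h at the first and X > h at
    the second, so continuity squeezes X at tau. The case tau = 0 is covered by the same
    argument. *)
Lemma drifted_at_passage (w : Omega) (tau : R) :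
  drifted W m 0 w <= h -> 0 <= tau -> lbound (passage w) tau ->
  (forall e, 0 < e -> exists2 t, passage w t & t < tau + e) ->
  drifted W m tau w = h.
Proof.
move=> w0 tau0 lb ad.
suff H e : 0 < e -> `|drifted W m tau w - h| <= e.
  apply/eqP; rewrite -subr_eq0 -normr_le0; apply/ler_addgt0Pr => e e0.
  by rewrite add0r H.
move=> e0; have [eta eta0 cX] := drifted_continuous w tau0 e0.
have eta4 : 0 < eta / 4 by rewrite divr_gt0.
have [n [/= nm [k [_ [bk hk] /andP[tk kt]]]]] : exists n, mesh n < eta / 4 /\
    exists k, [/\ (k < steps n)%N,
    crossing (grid W m (mesh n)) h k w & tau <= k.+1%:R * mesh n <= tau + 2 * (eta / 4)].
  near \oo => n; exists n; split; first by near: n; exact: mesh_small.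
  by near: n; apply: crossing_near => //; exact: ad.
have nm0 := @mesh_gt0 R n.
have bkk := bk k (leqnn k).
have kE : k.+1%:R * mesh n = k%:R * mesh n + mesh n :> R by rewrite -natr1 mulrDl mul1r.
have := cX (k.+1%:R * mesh n); rewrite mulr_ge0 ?(ltW nm0)// => /(_ isT).
have -> : `|k.+1%:R * mesh n - tau| < eta by rewrite ltr_norml; apply/andP; split; lra.
move=> /(_ isT); rewrite -/(grid W m (mesh n) k.+1 w) => X1.
have := cX (k%:R * mesh n); rewrite mulr_ge0 ?(ltW nm0)// => /(_ isT).
have -> : `|k%:R * mesh n - tau| < eta by rewrite ltr_norml; apply/andP; split; lra.
move=> /(_ isT); rewrite -/(grid W m (mesh n) k w) => X2.
move: X1 X2 hk bkk; rewrite !ltr_norml ler_norml => /andP[? ?] /andP[? ?] ? ?.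
by apply/andP; split; lra.
Unshelve. all: by end_near. Qed.

Lemma truncated_sum_crossing q n k (w : Omega) : (k < steps n)%N ->
  crossing (grid W m (mesh n)) h k w ->
  truncated_sum W m h q n w = truncated_mart W m h q (k.+1%:R * mesh n) w.
Proof.
move=> kn ck; rewrite /truncated_sum (bigD1 (Ordinal kn))//= big1 ?addr0.
  by rewrite indicE mem_set// mul1r.
move=> i ik; rewrite indicE memNset ?mul0r// => ci.
by move: ik; rewrite -val_eqE/= (crossing_inj ci ck) eqxx.
Qed.

(** The grid crossing times tend to tau and the capped exponential is continuous along the path; at
    tau the cap is inactive, because X = h < h + 1. *)
Lemma truncated_sum_cvg q (w : Omega) n0 :
  drifted W m 0 w <= h -> h < drifted W m n0%:R w ->
  ((truncated_sum W m h q n w)%:E @[n --> \oo] -->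
   (expR (q * h))%:E * expeR ((- cgf m q)%:E * first_passage (drifted W m) h w))%E.
Proof.
move=> w0 wn0; have [tau [-> tau0 lb ad]] := first_passage_fin wn0.
have Xtau := drifted_at_passage w0 tau0 lb ad.
rewrite -EFinM -expRD.
apply/cvg_EFin; first exact: nearW.
pose F t := truncated_mart W m h q t w.
have Ftau : F tau = expR (q * h + - cgf m q * tau).
  rewrite /F /truncated_mart Xtau (min_idPl _) ?lerDl// mulNr //.
have cF : {within `[0, +oo[, continuous F}.
  apply/subspace_continuousP => t At.
  have /subspace_continuousP /(_ t At) cX := @drifted_within w.
  apply: (@cvg_comp _ _ _
    (fun t => q * Num.min (drifted W m t w) (h + 1) - cgf m q * t) (@expR R));
    last exact: continuous_expR.
  apply: cvgB.
    apply: cvgMl_tmp.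
    apply: (@continuous2_cvg _ _ _ _ _ _ (drifted W m ^~ w) (cst (h + 1)) Num.min).
    - have minc : {for (drifted W m t w, h + 1), continuous
          ((fun z : R * R => z.1 : R^o) \min (fun z : R * R => z.2 : R^o))}.
        by apply: continuous_min; [exact: cvg_fst|exact: cvg_snd].
      exact: minc.
    - exact: cX.
    - exact: cvg_cst.
  apply: cvgMl_tmp; exact: cvg_within.
rewrite -Ftau; apply/cvgrPdist_lt => e e0.
have [eta eta0 H] := within_halflineP cF tau0 e0.
have eta4 : 0 < eta / 4 by rewrite divr_gt0.
near=> n.
have [k [kn ck /andP[tk kt]]] : exists k, [/\ (k < steps n)%N,
    crossing (grid W m (mesh n)) h k w & tau <= k.+1%:R * mesh n <= tau + 2 * (eta / 4)].
  by near: n; apply: crossing_near => //; exact: ad.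
rewrite /= (truncated_sum_crossing q kn ck) -/(F _) distrC; apply: H.
  by rewrite mulr_ge0// ltW// mesh_gt0.
by rewrite ltr_norml; apply/andP; split; lra.
Unshelve. all: by end_near. Qed.

End first_passage_path.

Lemma measurable_expeR (R : realType) : measurable_fun setT (@expeR R).
Proof.
apply: (measurability _ (ErealGenInftyO.measurableE R)) => _ /= -[_ [r ->] <-].
rewrite setTI; have [r0|r0] := leP r 0.
  rewrite (_ : _ @^-1` _ = set0)//; apply/seteqP; split=> // y /=.
  rewrite in_itv/= => /(le_lt_trans (expeR_ge0 y)).
  by rewrite lte_fin ltNge r0.
rewrite (_ : _ @^-1` _ = [set` `]-oo, (ln r)%:E[%O]); first exact: emeasurable_itv.
apply/seteqP; split=> y /=; rewrite !in_itv/=.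
  have -> : r%:E = expeR (ln r)%:E by rewrite /= lnK.
  by rewrite lte_expeR.
have -> : r%:E = expeR (ln r)%:E by rewrite /= lnK.
by rewrite lte_expeR.
Qed.

(** * Measurability of the first passage time *)

Section first_passage_measurable.
Context {d : measure_display} {Omega : measurableType d} {R : realType}.
Context {P : probability Omega R} (W : R -> {RV P >-> R}).
Hypothesis hW : standard_brownian_motion W.
Variables m h : R.

Let grid_time n j (w : Omega) : \bar R :=
  if h < grid W m (mesh n) j w then (j%:R * mesh n)%:E else +oo%E.

(** Every passage time is approached from the right by passages at grid points, so the infimum over
    real times is a countable one. *)
Lemma first_passage_grid (w : Omega) : first_passage (drifted W m) h w =
  einfs (fun n => einfs (fun j => grid_time n j w) 0%N) 0%N.
Proof.
apply/eqP; rewrite eq_le; apply/andP; split.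
  apply: le_ereal_inf_tmp => _ [n _ <-]; apply: le_ereal_inf_tmp => _ [j _ <-].
  rewrite /grid_time; case: ifPn => [hj|_]; last exact: leey.
  apply: ereal_inf_lbound; exists (j%:R * mesh n) => //; split=> //.
  by rewrite mulr_ge0// ltW// mesh_gt0.
apply: le_ereal_inf_tmp => _ [t ht <-]; apply/lee_addgt0Pr => e e0.
have [n [j /andP[_ jt] hj]] : exists n, exists2 j : nat,
    t < j%:R * mesh n <= t + e & h < grid W m (mesh n) j w.
  by near \oo => n; exists n; near: n; exact: grid_passage.
apply: (@le_trans _ _ (einfs (fun j => grid_time n j w) 0%N)).
  by apply: ereal_inf_lbound; exists n.
apply: (@le_trans _ _ (grid_time n j w)).
  by apply: ereal_inf_lbound; exists j.
by rewrite /grid_time hj -EFinD lee_fin.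
Unshelve. all: by end_near. Qed.

Lemma measurable_first_passage :
  measurable_fun setT (first_passage (drifted W m) h).
Proof.
rewrite (_ : first_passage _ _ = fun w =>
  einfs (fun n => einfs (fun j => grid_time n j w) 0%N) 0%N); last first.
  by apply/funext => w; exact: first_passage_grid.
apply: (@measurable_fun_einfs _ _ _ _ (fun n w => einfs (fun j => grid_time n j w) 0%N)) => n.
apply: measurable_fun_einfs => j.
apply: measurable_fun_ifT => //.
by apply: measurable_fun_ltr => //; exact: measurable_grid.
Qed.

End first_passage_measurable.

(** * Domination, and the moment generating function of the passage time *)

Section domination.
Context {d : measure_display} {Omega : measurableType d} {R : realType}.
Context {P : probability Omega R} (W : R -> {RV P >-> R}).
Hypothesis hW : standard_brownian_motion W.
Variables m h : R.
Hypotheses (m_gt0 : 0 < m) (h_gt0 : 0 < h).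

Let late (c : R) j (w : Omega) : \bar R :=
  (expR (c * j.+1%:R) * \1_[set w | drifted W m j%:R w <= h] w)%:E.

(* If [h] is first exceeded at a time [t] of a grid containing the integers, and
   [j < t <= j.+1], then [X j <= h], so [late c j] dominates [expR (c * t)]. *)
Definition passage_envelope (c : R) (w : Omega) : \bar R :=
  (\sum_(0 <= j <oo) late c j w)%E.

Let late_ge0 c j w : (0 <= late c j w)%E.
Proof. by rewrite lee_fin mulr_ge0// expR_ge0. Qed.

Let measurable_late c j : measurable_fun setT (late c j).
Proof.
apply/measurable_EFinP; apply: measurable_funM => //; apply: measurable_indic.
rewrite -[X in measurable X]setTI; apply: measurable_fun_le => //.
exact: measurable_drifted.
Qed.

(** Markov's inequality with exponent - m, the minimiser of psi, bounds the probability of X_j <= h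
    by exp (m h - m^2 j / 2). For c <= m^2 / 4 the weights exp (c (j + 1)) leave a geometric series
    of ratio exp (- m^2 / 4). *)
Lemma passage_envelope_integrable (c : R) : 0 <= c -> c <= m ^+ 2 / 4 ->
  P.-integrable setT (passage_envelope c).
Proof.
move=> c0 cm.
have mE : measurable_fun setT (passage_envelope c).
  by apply: ge0_emeasurable_sum => //.
apply/integrableP; split=> //.
under eq_integral do rewrite gee0_abs ?nneseries_ge0//.
rewrite integral_nneseries//.
pose a : R := expR (c + m * h); pose x : R := expR (- (m ^+ 2 / 4)).
have x0 : 0 < x by rewrite expR_gt0.
have x1 : `|x| < 1.
  by rewrite gtr0_norm// -expR0 ltr_expR oppr_lt0 divr_gt0// exprn_gt0.
have le_term j : (\int[P]_w late c j w <= (geometric a x j)%:E)%E.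
  have jj : 0 <= j%:R :> R by rewrite ler0n.
  apply: (@le_trans _ _ (\int[P]_w ((expR (c * j.+1%:R + m * h))%:E *
      (expR (- m * drifted W m j%:R w))%:E))%E).
    apply: ge0_le_integral => //.
    - apply: measurable_funeM; apply/measurable_EFinP; apply: measurableT_comp => //.
      by apply: measurable_funM => //; exact: measurable_drifted.
    - move=> w _; rewrite -EFinM lee_fin -expRD indicE.
      have [|_] := boolP (w \in _); last by rewrite mulr0 expR_ge0.
      rewrite inE/= => Xh; rewrite mulr1 ler_expR.
      have : m * drifted W m j%:R w <= m * h by rewrite ler_pM2l.
      lra.
  rewrite ge0_integralZl//; last first.
    apply/measurable_EFinP; apply: measurableT_comp => //.
    by apply: measurable_funM => //; exact: measurable_drifted.
  rewrite (drifted_mgf hW m (- m) jj) -EFinM lee_fin -expRD /= /a /x -expRM_natl -expRD.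
  rewrite ler_expR /cgf -natr1.
  have : c * j%:R <= m ^+ 2 / 4 * j%:R by rewrite ler_wpM2r.
  lra.
apply: (@le_lt_trans _ _ (a * (1 - x)^-1)%:E); last exact: ltry.
apply: lime_le.
  by apply: is_cvg_nneseries => j _ _; exact: integral_ge0.
apply: nearW => n.
apply: (@le_trans _ _ (series (geometric a x) n)%:E).
  by rewrite /series/= -sumEFin; apply: lee_sum => j _; exact: le_term.
by rewrite lee_fin; apply: geometric_le_lim => //; rewrite expR_ge0.
Qed.

(** If X stays at or below h at all integers, every term is at least 1 and the sum diverges.
    Integrability of the envelope thus yields the almost sure finiteness of T. *)
Lemma passage_envelope_finite (c : R) (w : Omega) : 0 <= c ->
  passage_envelope c w \is a fin_num -> exists j : nat, h < drifted W m j%:R w.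
Proof.
move=> c0 fin; apply: contrapT => /forallNP H.
have Xh j : drifted W m j%:R w <= h by rewrite leNgt; apply/negP/H.
have part n : (n%:R%:E <= passage_envelope c w)%E.
  apply: (@le_trans _ _ (\sum_(0 <= i < n) late c i w)%E); last first.
    by apply: nneseries_lim_ge => i _ _; exact: late_ge0.
  apply: (@le_trans _ _ (\sum_(0 <= i < n) 1%:E)%E).
    by rewrite sumEFin sumr_const_nat subn0.
  apply: lee_sum => j _; rewrite lee_fin indicE mem_set ?mulr1//; last exact: Xh.
  by rewrite -expR0 ler_expR mulr_ge0.
move: fin => /fineK fE; have := part (Num.truncn (fine (passage_envelope c w))).+1.
by rewrite -fE lee_fin leNgt truncnS_gt.
Qed.

(** If the crossing index is k + 1 and j = k / 4^n rounded down, the crossing time lies in ]j, j +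
    1] and the integer j is a grid point not after index k, so X_j <= h and the j-th term of the
    envelope is present. *)
Lemma truncated_sum_le_envelope q n (w : Omega) :
  ((truncated_sum W m h q n w)%:E <=
   (expR (`|q| * (h + 1)))%:E * passage_envelope `|cgf m q| w)%E.
Proof.
have env0 : (0 <= passage_envelope `|cgf m q| w)%E by apply: nneseries_ge0.
have [[k [kn ck]]|nk] := pselect (exists k, (k < steps n)%N /\
    crossing (grid W m (mesh n)) h k w); last first.
  rewrite /truncated_sum big1 ?mule_ge0 ?lee_fin ?expR_ge0// => i _.
  rewrite indicE memNset ?mul0r// => ci; apply: nk; exists i; split => //.
rewrite (truncated_sum_crossing q kn ck).
have [bk xk] := ck.
pose j := (k %/ 4 ^ n)%N.
have p4 : (0 < 4 ^ n)%N by rewrite expn_gt0.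
have jk : (j * 4 ^ n <= k)%N by exact: leq_divM.
have kj : (k.+1 <= j.+1 * 4 ^ n)%N by rewrite ltn_ceil.
have m4 : (4 ^ n)%:R * mesh n = 1 :> R.
  by rewrite /mesh natrX exprVn mulfV// expf_neq0.
have tj : k.+1%:R * mesh n <= j.+1%:R :> R.
  have -> : j.+1%:R = (j.+1 * 4 ^ n)%:R * mesh n :> R by rewrite natrM -mulrA m4 mulr1.
  by rewrite ler_pM2r ?mesh_gt0// ler_nat.
have Xj : drifted W m j%:R w <= h.
  have := bk _ jk; rewrite /grid natrM -mulrA m4 mulr1//.
apply: (@le_trans _ _ ((expR (`|q| * (h + 1)))%:E * late `|cgf m q| j w)%E); last first.
  rewrite lee_pmul2l// ?lte_fin ?expR_gt0//.
  apply: (@le_trans _ _ (\sum_(0 <= i < j.+1) late `|cgf m q| i w)%E); last first.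
    by apply: nneseries_lim_ge => i _ _; exact: late_ge0.
  by rewrite big_nat_recr//= leeDr// sume_ge0.
rewrite -EFinM lee_fin indicE mem_set// mulr1 -expRD ler_expR.
rewrite lerD//.
  set x := Num.min _ _.
  have x0 : 0 <= x by rewrite le_min (le_trans _ (ltW xk)) ?addr_ge0 ?(ltW h_gt0).
  apply: (@le_trans _ _ (`|q| * x)); first by rewrite ler_wpM2r ?ler_norm.
  by rewrite ler_wpM2l// ge_min lexx orbT.
apply: (@le_trans _ _ (`|cgf m q| * (k.+1%:R * mesh n))).
  by rewrite -mulNr ler_wpM2r ?mulr_ge0 ?(ltW (mesh_gt0 _))// -normrN ler_norm.
by rewrite ler_wpM2l.
Qed.

(** Dominated convergence identifies the limit 1 of the means with the mean of the pointwise limit.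
    The three smallness conditions serve, in order, the tail below h, the overshoot errors and the
    envelope. *)
Lemma first_passage_mgf q : `|q| <= m / 2 -> `|cgf m q| <= 2^-1 ->
  `|cgf m q| <= m ^+ 2 / 4 ->
  mgf P (first_passage (drifted W m) h) (- cgf m q) = (expR (- (q * h)))%:E.
Proof.
move=> qm cq1 cq2.
pose F w := ((expR (q * h))%:E *
  expeR ((- cgf m q)%:E * first_passage (drifted W m) h w))%E.
have mexp : measurable_fun setT (fun w =>
    expeR ((- cgf m q)%:E * first_passage (drifted W m) h w)%E).
  apply: measurableT_comp; first exact: measurable_expeR.
  by apply: measurable_funeM; exact: measurable_first_passage.
have mF : measurable_fun setT F by exact: measurable_funeM.
have envI : P.-integrable setT (fun w =>
    ((expR (`|q| * (h + 1)))%:E * passage_envelope `|cgf m q| w)%E).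
  by apply: integrableZl => //; exact: passage_envelope_integrable.
have mS n : measurable_fun setT (fun w => (truncated_sum W m h q n w)%:E).
  by apply/measurable_EFinP; exact: measurable_truncated_sum.
have aeS : {ae P, forall w, setT w -> (truncated_sum W m h q n w)%:E @[n --> \oo] --> F w}.
  have cq0 := normr_ge0 (cgf m q).
  have aeE := integrable_ae measurableT (passage_envelope_integrable cq0 cq2).
  apply: filterS2 (bm_start hW) aeE => w w0 /(_ I) /(passage_envelope_finite cq0)[j hj] _.
  apply: truncated_sum_cvg hj => //.
  by rewrite /drifted w0 mulr0 addr0 ltW.
have dom : {ae P, forall w n, setT w -> (`|(truncated_sum W m h q n w)%:E| <=
    (expR (`|q| * (h + 1)))%:E * passage_envelope `|cgf m q| w)%E}.
  apply: aeW => w n _; rewrite gee0_abs; first exact: truncated_sum_le_envelope.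
  by rewrite lee_fin sumr_ge0// => k _; rewrite mulr_ge0// expR_ge0.
have [_ _ Fcvg] := dominated_convergence measurableT mS mF aeS envI dom.
have := cvg_unique _ Fcvg (truncated_sum_mean_cvg hW m_gt0 h_gt0 qm cq1).
rewrite /F ge0_integralZl//; last by move=> w _; rewrite expeR_ge0.
move=> /(_ (@ereal_hausdorff R)) H.
rewrite /mgf expRN.
transitivity (((expR (q * h))^-1)%:E * ((expR (q * h))%:E *
   \int[P]_x expeR ((- cgf m q)%:E * first_passage (drifted W m) h x)))%E.
  by rewrite muleA -EFinM mulVf ?mul1e// gt_eqF// expR_gt0.
by rewrite (H _) mule1.
Qed.

End domination.

(** * Cumulants of the first passage time *)

Section cumulants_of_first_passage.
Context {d : measure_display} {Omega : measurableType d} {R : realType}.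
Context {P : probability Omega R} (W : R -> {RV P >-> R}).
Hypothesis hW : standard_brownian_motion W.
Variables m h : R.
Hypotheses (m_gt0 : 0 < m) (h_gt0 : 0 < h).

Let T := first_passage (drifted W m) h.

(** Of the two roots of psi q = - z the one vanishing with z is q = s - m, where s = sqrt (m^2 - 2
    z). The bound on z keeps s between m / 2 and 3 m / 2, so |q| <= m / 2. *)
Lemma first_passage_mgf_sqrt z : `|z| < Num.min (2^-1) (m ^+ 2 / 16) ->
  mgf P T z = (expR (h * m * (1 - Num.sqrt (1 - 2 / m ^+ 2 * z))))%:E.
Proof.
rewrite lt_min => /andP[z1 z2]; have m2 : 0 < m ^+ 2 by rewrite exprn_gt0.
have zb : - (m ^+ 2 / 16) < z < m ^+ 2 / 16 by rewrite -ltr_norml.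
pose s := Num.sqrt (m ^+ 2 - 2 * z).
have pos : 0 <= m ^+ 2 - 2 * z by lra.
have s2 : s ^+ 2 = m ^+ 2 - 2 * z by rewrite sqr_sqrtr.
have s0 : 0 <= s by rewrite sqrtr_ge0.
have sE : s = m * Num.sqrt (1 - 2 / m ^+ 2 * z).
  rewrite /s (_ : m ^+ 2 - 2 * z = m ^+ 2 * (1 - 2 / m ^+ 2 * z)); last first.
    by field; rewrite gt_eqF.
  by rewrite sqrtrM ?(ltW m2)// sqrtr_sqr gtr0_norm.
have zE : z = - cgf m (s - m).
  by rewrite /cgf; move: s2; nra.
have qm : `|s - m| <= m / 2.
  have l1 : m / 2 <= s.
    rewrite -(@ler_pXn2r _ 2) ?nnegrE ?divr_ge0 ?(ltW m_gt0)// s2.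
    by rewrite (_ : (m / 2) ^+ 2 = m ^+ 2 / 4); [lra|field].
  have l2 : s <= 3 / 2 * m.
    rewrite -(@ler_pXn2r _ 2) ?nnegrE ?mulr_ge0 ?divr_ge0 ?(ltW m_gt0)// s2.
    by rewrite (_ : (3 / 2 * m) ^+ 2 = 9 / 4 * m ^+ 2); [lra|field].
  by rewrite ler_norml; apply/andP; split; lra.
rewrite [in LHS]zE first_passage_mgf//.
- by rewrite sE; congr (expR _)%:E; ring.
- by rewrite -normrN -zE ltW.
- by rewrite -normrN -zE (le_trans (ltW z2))// ler_pM2l// lef_pV2 ?posrE// ler_nat.
Qed.

(** The Taylor coefficients of h m (1 - sqrt (1 - 2 z / m^2)), multiplied by k!. The value at k = 0
    is not the constant term, but cumulant series start at k = 1. *)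
Definition ig_cumulant (k : nat) : R :=
  - (h * m) * sqrt_coef k * (2 / m ^+ 2) ^+ k * k`!%:R.

Lemma ig_cumulantP : is_cumulant_seq P T ig_cumulant.
Proof.
have m2 : 0 < m ^+ 2 by rewrite exprn_gt0.
exists (Num.min (2^-1) (m ^+ 2 / 16)).
  by rewrite lt_min invr_gt0 ltr0n/= divr_gt0.
move=> z zr; rewrite first_passage_mgf_sqrt//=; split=> //.
rewrite expRK; set u := 2 / m ^+ 2 * z.
have u4 : `|u| < 4^-1.
  move: zr; rewrite lt_min => /andP[_ zr].
  rewrite /u normrM gtr0_norm ?divr_gt0// mulrAC ltr_pdivrMr//; lra.
(* After the shift the partial sums of the square root contain their constant term 1, which cancels
   the 1 in front. *)
rewrite -sqrt_seriesE// -cvg_shiftS.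
rewrite [X in X @ _ --> _](_ : _ = fun n => h * m * (1 - pseries sqrt_coef u n.+1)).
  apply: cvgMl_tmp; apply: cvgB; first exact: cvg_cst.
  by rewrite (cvg_shiftS (pseries sqrt_coef u)); exact: is_cvg_sqrt_series.
apply/funext => n; rewrite /pseries /series/= big_add1/= big_nat_recl// expr0 mulr1.
rewrite opprD addrA subrr add0r mulrN mulr_sumr -sumrN.
apply: eq_bigr => i _; rewrite /ig_cumulant /u [in RHS]exprMn.
set v := (2 / m ^+ 2) ^+ _; set zi := z ^+ _; set a := sqrt_coef _.
by field; rewrite pnatr_eq0 -lt0n fact_gt0.
Qed.

(** The sequence chosen by [xget] and the explicit one represent the same function near 0, so they
    agree at 1 and 2; there the square root has the coefficients - 1/2 and - 1/8. *)
Lemma cumulant_first_passage :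
  cumulant P T 1 = h / m /\ cumulant P T 2 = h / m ^+ 3.
Proof.
have ex : exists c, is_cumulant_seq P T c by exists ig_cumulant; exact: ig_cumulantP.
have [r1 r10 H1] : is_cumulant_seq P T (cumulant P T).
  by have [c hc] := ex; exact: (xgetI (fun=> 0) hc).
have [r2 r20 H2] := ig_cumulantP.
have r0 : 0 < Num.min r1 r2 by rewrite lt_min r10.
have [] := @cumulant_series_coef _ (cumulant P T) ig_cumulant
    (fun z => ln (fine (mgf P T z))) _ r0.
- by move=> z; rewrite lt_min => /andP[/H1[]].
- by move=> z; rewrite lt_min => /andP[_ /H2[]].
move=> -> ->.
have a1 : sqrt_coef 1 = - 2^-1 :> R by rewrite /=; field.
have a2 : sqrt_coef 2 = - 8^-1 :> R by rewrite [sqrt_coef 2]/= -/(sqrt_coef 1) a1; field.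
have f2 : 2`!%:R = 2 :> R by [].
have f1 : 1`!%:R = 1 :> R by [].
rewrite /ig_cumulant a1 a2 f1 f2; split; field; by rewrite gt_eqF.
Qed.

End cumulants_of_first_passage.

Lemma first_passage_geometric_bm {d : measure_display} {Omega : measurableType d}
    {R : realType} {P : probability Omega R} (W : R -> {RV P >-> R})
    (mu sigma y0 S : R) : 0 < sigma -> 0 < y0 -> 0 < S ->
  first_passage (geometric_bm W mu sigma y0) S =
  first_passage (drifted W ((mu - sigma ^+ 2 / 2) / sigma)) ((ln S - ln y0) / sigma).
Proof.
move=> s0 y00 S0; apply/funext => w; rewrite /first_passage; congr ereal_inf.
congr image; apply/funext => t; congr (_ /\ is_true _).
rewrite /geometric_bm /drifted -{1}(lnK S0) -{1}(lnK y00) -expRD ltr_expR.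
rewrite ltr_pdivrMr// ltrBlDl; congr (_ < _).
by field; rewrite gt_eqF.
Qed.

Theorem corollary3p2 (d : measure_display) (Omega : measurableType d)
    (R : realType) (P : probability Omega R) (W : R -> {RV P >-> R})
    (mu sigma y0 S alpha beta : R)
    (hW : standard_brownian_motion W)
    (hsigma : 0 < sigma) (hmu : sigma ^+ 2 / 2 < mu)
    (hy0 : 0 < y0) (hS : y0 < S)
    (halpha : -1 < alpha) (hbeta : 0 < beta) :
  let T := first_passage (geometric_bm W mu sigma y0) S in
  let a := ig_a sigma y0 S in
  let b := ig_b mu sigma y0 S in
  let A := a / b ^+ 2 - beta in
  ((\int[lebesgue_measure]_(t in `]0%R, +oo[)
      (t `^ (- (alpha + 3)) * expR (- A * t - a / t))%:E < +oo)%E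
   <-> beta <= cumulant P T 1 / cumulant P T 2)
  /\ cumulant P T 1 / cumulant P T 2
     = 1 / sigma ^+ 2 * (mu - sigma ^+ 2 / 2) ^+ 2.
Proof.
move=> T a b A.
have S0 : 0 < S by rewrite (lt_trans hy0).
have l0 : 0 < ln S - ln y0 by rewrite subr_gt0 ltr_ln.
have nu0 : 0 < mu - sigma ^+ 2 / 2 by rewrite subr_gt0.
have m0 : 0 < (mu - sigma ^+ 2 / 2) / sigma by rewrite divr_gt0.
have h0 : 0 < (ln S - ln y0) / sigma by rewrite divr_gt0.
have ratio : cumulant P T 1 / cumulant P T 2
     = 1 / sigma ^+ 2 * (mu - sigma ^+ 2 / 2) ^+ 2.
  rewrite /T first_passage_geometric_bm//.
  have [-> ->] := cumulant_first_passage hW m0 h0.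
  move: l0 nu0; set l := ln S - ln y0; set nu := mu - _ => l0 nu0.
  by field; rewrite !gt_eqF.
split=> //; rewrite ratio.
have a0 : 0 < a by rewrite /a /ig_a divr_gt0// exprn_gt0.
have p2 : 2 <= alpha + 3 by lra.
apply: (iff_trans (gig_kernel_integral_finiteP A a0 p2)).
rewrite subr_ge0; suff -> : a / b ^+ 2 = 1 / sigma ^+ 2 * (mu - sigma ^+ 2 / 2) ^+ 2 by [].
rewrite /a /b /ig_a /ig_b.
move: l0 nu0; set l := ln S - ln y0; set nu := mu - _ => l0 nu0.
by field; rewrite !gt_eqF.
Qed.
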